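(* Assume the framework in the context, that each $m_i$ is $\delta_i$-Ahlfors regular, that $\{\mathcal R_{\alpha,i}\}_{\alpha\in J}$ has the $\kappa$-scaling property for each $1\le i\le d$ (for some fixed $0\le\kappa<1$), and that $(\{\mathcal R_\alpha\}_{\alpha\in J},\beta)$ is a local ubiquity system for rectangles with respect to $(\rho,\mathbf a)$, where $\mathbf a=(a_1,\dots,a_d)\in(0,\infty)^d$. Then for every $\mathbf t=(t_1,\dots,t_d)\in(0,\infty)^d$, $$\dim_H W(\mathbf t)\ \ge\ s(\mathbf t).$$
   Context: Fix an integer $d\ge1$. For each $1\le i\le d$, $(X_i,|\cdot|_i)$ is a bounded locally compact metric space carrying a Borel probability measure $m_i$. The measure $m_i$ is $\delta_i$-Ahlfors regular ($\delta_i>0$) if there are constants $c,C,r_0>0$ with $c\,r^{\delta_i}\le m_i(B(x,r))\le C\,r^{\delta_i}$ for all $x\in X_i$ and $0<r\le r_0$. Put $X=\prod_{i=1}^dX_i$ with metric $|x-y|=\max_i|x_i-y_i|_i$ and measure $m=\prod_i m_i$; thus a ball in $X$ is $B(x,r)=\prod_iB(x_i,r)$. For $E\subset X_i$ and $\epsilon>0$, $\Delta(E,\epsilon)=\{y\in X_i:\operatorname{dist}(y,E)<\epsilon\}$. $J$ is an infinite countable index set and $\beta:J\to(0,\infty)$, $\alpha\mapsto\beta_\alpha$, satisfies: $\{\alpha:\beta_\alpha<M\}$ is finite for every $M>1$. $\{\ell_n\},\{u_n\}$ are increasing sequences with $\ell_n\le u_n$, $\ell_n\to\infty$, and $J_n=\{\alpha\in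 J:\ell_n\le\beta_\alpha\le u_n\}$. $\rho:(0,\infty)\to(0,\infty)$ is non-increasing with $\rho(u)\to0$ as $u\to\infty$. For each $i$, $\{\mathcal R_{\alpha,i}:\alpha\in J\}$ are subsets of $X_i$ and $\mathcal R_\alpha=\prod_i\mathcal R_{\alpha,i}$. For $\mathbf b=(b_1,\dots,b_d)\in(0,\infty)^d$ and $r>0$, $\Delta(\mathcal R_\alpha,r^{\mathbf b})=\prod_{i=1}^d\Delta(\mathcal R_{\alpha,i},r^{b_i})$. $\kappa$-scaling property ($0\le\kappa<1$): there are constants $c_2,c_3>0$ such that for every $\alpha\in J$, every $x_i\in\mathcal R_{\alpha,i}$ and every $0<\epsilon<r$ (with $r$ sufficiently small), $c_2r^{\delta_i\kappa}\epsilon^{\delta_i(1-\kappa)}\le m_i(B(x_i,r)\cap\Delta(\mathcal R_{\alpha,i},\epsilon))\le c_3r^{\delta_i\kappa}\epsilon^{\delta_i(1-\kappa)}$. Local ubiquity system for rectangles w.r.t. $(\rho,\mathbf a)$: there is $c>0$ such that for every ball $B\subset X$, $\limsup_{n\to\infty}m\big(B\cap\bigcup_{\alpha\in J_n}\Delta(\mathcal R_\alpha,\rho(u_n)^{\mathbf a})\big)\ge c\,m(B)$. For $\mathbf t\in[0,\infty)^d$: $W(\mathbf t)=\{x\in X: x\in\Delta(\mathcal R_\alpha,\rho(\beta_\alpha)^{\mathbf a+\mathbf t})\text{ for infinitely many }\alpha\in J\}$. Dimensional number: let $\mathcal A=\{a_i,\ a_i+t_i:1\le i\le d\}$. For $A\in\mathcal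 A$ let $\mathcal K_1=\{k:a_k\ge A\}$, $\mathcal K_2=\{k:a_k+t_k\le A\}\setminus\mathcal K_1$, $\mathcal K_3=\{1,\dots,d\}\setminus(\mathcal K_1\cup\mathcal K_2)$, and $$s(\mathbf t)=\min_{A\in\mathcal A}\Big\{\sum_{k\in\mathcal K_1}\delta_k+\sum_{k\in\mathcal K_2}\delta_k+\kappa\sum_{k\in\mathcal K_3}\delta_k+(1-\kappa)\frac{\sum_{k\in\mathcal K_3}a_k\delta_k-\sum_{k\in\mathcal K_2}t_k\delta_k}{A}\Big\}.$$ *)

(* Defs.v *)
From Stdlib Require Import Reals.
From mathcomp Require Import ssreflect ssrfun ssrbool eqtype ssrnat seq fintype.
Set Implicit Arguments.
Unset Strict Implicit.
Open Scope R_scope.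

Definition sumI (d : nat) (f : 'I_d -> R) : R := foldr (fun k acc => f k + acc) 0 (enum 'I_d).
Definition prodI (d : nat) (f : 'I_d -> R) : R := foldr (fun k acc => f k * acc) 1 (enum 'I_d).
Definition maxI (d : nat) (f : 'I_d -> R) : R := foldr (fun k acc => Rmax (f k) acc) 0 (enum 'I_d).
Definition min_list (l : seq R) : R :=
  match l with nil => 0 | x :: l' => foldr Rmin x l' end.

Definition is_metric (T : Type) (dist : T -> T -> R) : Prop :=
  (forall x y, 0 <= dist x y) /\ (forall x y, dist x y = 0 <-> x = y) /\
  (forall x y, dist x y = dist y x) /\
  (forall x y z, dist x z <= dist x y + dist y z).

Definition ball (T : Type) (dist : T -> T -> R) (x : T) (r : R) : T -> Prop :=
  fun y => dist x y < r.

Definition bounded_space (T : Type) (dist : T -> T -> R) : Prop :=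
  exists M, forall x y, dist x y <= M.

Definition open_set (T : Type) (dist : T -> T -> R) (U : T -> Prop) : Prop :=
  forall x, U x -> exists r, 0 < r /\ forall y, ball dist x r y -> U y.

Definition compact_set (T : Type) (dist : T -> T -> R) (K : T -> Prop) : Prop :=
  forall F : (T -> Prop) -> Prop,
    (forall U, F U -> open_set dist U) ->
    (forall x, K x -> exists U, F U /\ U x) ->
    exists l : seq (T -> Prop), (forall U, List.In U l -> F U) /\
      (forall x, K x -> exists U, List.In U l /\ U x).

Definition locally_compact (T : Type) (dist : T -> T -> R) : Prop :=
  forall x, exists K, compact_set dist K /\
    exists r, 0 < r /\ forall y, ball dist x r y -> K y.

Inductive sigma_gen (T : Type) (G : (T -> Prop) -> Prop) : (T -> Prop) -> Prop :=
| sg_base : forall A, G A -> sigma_gen G A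
| sg_compl : forall A, sigma_gen G A -> sigma_gen G (fun x => ~ A x)
| sg_union : forall F : nat -> T -> Prop, (forall n, sigma_gen G (F n)) ->
             sigma_gen G (fun x => exists n, F n x)
| sg_ext : forall A B, sigma_gen G A -> (forall x, A x <-> B x) -> sigma_gen G B.

Definition borel (T : Type) (dist : T -> T -> R) : (T -> Prop) -> Prop :=
  sigma_gen (open_set dist).

(* mu is a (finite, real-valued) measure on the sigma-algebra S;
   its values outside S are irrelevant. *)
Definition is_measure (T : Type) (S : (T -> Prop) -> Prop) (mu : (T -> Prop) -> R) : Prop :=
  mu (fun _ => False) = 0 /\
  (forall A, S A -> 0 <= mu A) /\
  (forall F : nat -> T -> Prop, (forall n, S (F n)) ->
     (forall n m x, n <> m -> F n x -> F m x -> False) ->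
     Un_cv (fun N => sum_f_R0 (fun n => mu (F n)) N) (mu (fun x => exists n, F n x))).

Definition borel_probability (T : Type) (dist : T -> T -> R) (mu : (T -> Prop) -> R) : Prop :=
  is_measure (borel dist) mu /\ mu (fun _ => True) = 1.

Definition ahlfors_regular (T : Type) (dist : T -> T -> R) (mu : (T -> Prop) -> R)
  (delta : R) : Prop :=
  exists c C r0, 0 < c /\ 0 < C /\ 0 < r0 /\
    forall x r, 0 < r <= r0 ->
      c * Rpower r delta <= mu (ball dist x r) /\ mu (ball dist x r) <= C * Rpower r delta.

Section Product.
Variables (d : nat) (T : 'I_d -> Type).
Variable dist : forall i, T i -> T i -> R.
Arguments dist : clear implicits.

Definition PX : Type := forall i : 'I_d, T i.

Definition prod_dist (x y : PX) : R := maxI (fun i => dist i (x i) (y i)).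

Definition rectangle (A : forall i, T i -> Prop) : PX -> Prop :=
  fun x => forall i, A i (x i).

Definition prod_sigma : (PX -> Prop) -> Prop :=
  sigma_gen (fun E => exists A : forall i, T i -> Prop,
                 (forall i, borel (dist i) (A i)) /\ E = rectangle A).

Definition is_product_measure (mi : forall i, (T i -> Prop) -> R) (m : (PX -> Prop) -> R) : Prop :=
  is_measure prod_sigma m /\
  forall A : forall i, T i -> Prop, (forall i, borel (dist i) (A i)) ->
    m (rectangle A) = prodI (fun i => mi i (A i)).

Definition prod_ball (x : PX) (r : R) : PX -> Prop :=
  rectangle (fun i => ball (dist i) (x i) r).
End Product.

Definition Delta (T : Type) (dist : T -> T -> R) (E : T -> Prop) (eps : R) : T -> Prop :=
  fun y => exists z, E z /\ dist y z < eps.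

Definition Delta_rect (d : nat) (T : 'I_d -> Type) (dist : forall i, T i -> T i -> R)
  (Ra : forall i, T i -> Prop) (r : R) (b : 'I_d -> R) : PX T -> Prop :=
  rectangle (fun i => Delta (dist i) (Ra i) (Rpower r (b i))).

Definition finite_pred (J : Type) (P : J -> Prop) : Prop :=
  exists l : seq J, forall x, P x -> List.In x l.

Definition countably_infinite (J : Type) : Prop :=
  exists (f : J -> nat) (g : nat -> J), cancel f g /\ cancel g f.

Definition kappa_scaling (J T : Type) (dist : T -> T -> R) (mu : (T -> Prop) -> R)
  (delta kappa : R) (E : J -> T -> Prop) : Prop :=
  exists c2 c3 r1, 0 < c2 /\ 0 < c3 /\ 0 < r1 /\
    forall alpha x eps r, E alpha x -> 0 < eps -> eps < r -> r < r1 ->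
      c2 * Rpower r (delta * kappa) * Rpower eps (delta * (1 - kappa))
        <= mu (fun y => ball dist x r y /\ Delta dist (E alpha) eps y) /\
      mu (fun y => ball dist x r y /\ Delta dist (E alpha) eps y)
        <= c3 * Rpower r (delta * kappa) * Rpower eps (delta * (1 - kappa)).

Definition J_n (J : Type) (beta : J -> R) (l u : nat -> R) (n : nat) : J -> Prop :=
  fun alpha => l n <= beta alpha <= u n.

Definition local_ubiquity (d : nat) (T : 'I_d -> Type) (dist : forall i, T i -> T i -> R)
  (m : (PX T -> Prop) -> R) (J : Type) (Rs : J -> forall i, T i -> Prop)
  (beta : J -> R) (l u : nat -> R) (rho : R -> R) (a : 'I_d -> R) : Prop :=
  exists c, 0 < c /\
    forall (x : PX T) (r : R), 0 < r ->
      (* limsup_n m(B cap U_n) >= c m(B), unfolded *)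
      forall (N : nat) (eta : R), 0 < eta ->
        exists n, (N <= n)%nat /\
          c * m (prod_ball dist x r) - eta <
          m (fun y => prod_ball dist x r y /\
                 exists alpha, J_n beta l u n alpha /\
                   Delta_rect dist (Rs alpha) (rho (u n)) a y).

Definition W_set (d : nat) (T : 'I_d -> Type) (dist : forall i, T i -> T i -> R)
  (J : Type) (Rs : J -> forall i, T i -> Prop) (beta : J -> R) (rho : R -> R)
  (a t : 'I_d -> R) : PX T -> Prop :=
  fun x => ~ finite_pred (fun alpha =>
             Delta_rect dist (Rs alpha) (rho (beta alpha)) (fun i => a i + t i) x).

Definition hausdorff_null (X : Type) (D : X -> X -> R) (s : R) (E : X -> Prop) : Prop :=
  forall delta eps, 0 < delta -> 0 < eps ->
    exists (U : nat -> X -> Prop) (r : nat -> R),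
      (forall n, 0 < r n <= delta) /\
      (forall n x y, U n x -> U n y -> D x y <= r n) /\
      (forall x, E x -> exists n, U n x) /\
      (forall N, sum_f_R0 (fun n => Rpower (r n) s) N <= eps).

(* dim_H E = inf { s > 0 : H^s(E) = 0 };  "dim_H E >= s0" means s0 is a
   lower bound of that set. *)
Definition dimH_ge (X : Type) (D : X -> X -> R) (E : X -> Prop) (s0 : R) : Prop :=
  forall s, 0 < s -> hausdorff_null D s E -> s0 <= s.

Section DimNumber.
Variables (d : nat) (delta a t : 'I_d -> R) (kappa : R).

Definition inK1 (A : R) (k : 'I_d) : bool := if Rle_dec A (a k) then true else false.
Definition inK2 (A : R) (k : 'I_d) : bool :=
  (if Rle_dec (a k + t k) A then true else false) && ~~ inK1 A k.
Definition inK3 (A : R) (k : 'I_d) : bool := ~~ inK1 A k && ~~ inK2 A k.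

Definition s_term (A : R) : R :=
  sumI (fun k => if inK1 A k then delta k else 0)
  + sumI (fun k => if inK2 A k then delta k else 0)
  + kappa * sumI (fun k => if inK3 A k then delta k else 0)
  + (1 - kappa) *
      (sumI (fun k => if inK3 A k then a k * delta k else 0)
       - sumI (fun k => if inK2 A k then t k * delta k else 0)) / A.

Definition dim_candidates : seq R := flatten (map (fun k => [:: a k; a k + t k]) (enum 'I_d)).

Definition s_dim : R := min_list (map s_term dim_candidates).
End DimNumber.

(* Main.v *)
From Stdlib Require Import Reals Lra Lia Classical ClassicalEpsilon.
From Stdlib Require Import FunctionalExtensionality PropExtensionality.
From mathcomp Require Import ssreflect ssrfun ssrbool eqtype ssrnat seq fintype.
Require Import Defs.
Set Implicit Arguments.
Unset Strict Implicit.
Open Scope R_scope.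

(** No mass distribution is constructed.  Suppose [0 < s < s(t)] and that sets [U_n] of diameter at
    most [r_n] cover [W(t)] with [sum_n r_n^s] tiny.  Call a ball [B] of radius [R] cheaply met if the
    [U_n] meeting [B] satisfy [sum r_n^s <= tau R^s]; then each of them has [r_n < R].  Ubiquity and the
    scaling property yield, inside such a [B], many disjoint balls of one small radius [R'], each
    contained in some [Delta(R_alpha, rho(u_n)^(a+t))]; the proportion of them meeting a given set of
    diameter [r = rho(u_n)^A >= R'] is at most a constant times [R^(- sum delta) rho(u_n)^F(A)], where [F]
    is piecewise affine in [A] and [F(A) >= s(t) A].  Averaging the normalised cost over these balls,
    with [U_n] of diameter above [R'] charged 2, produces a smaller ball that is again cheaply met.
    The common point of the resulting nested balls lies in [W(t)], but in no [U_n]. *)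

(** * Finite families, measures and counting *)

(** One constant [tau] has to survive every generation, whereas R^(- sum delta) grows without bound
    along the descent: ubiquity supplies some large n but no lower control of rho(u_n), so R'/R has
    no lower bound. The strict gap between s and s(t) pays for this. Since F(A) >= s(t) A, the
    proportion of balls met by a set of diameter r is at most a constant times R^(- sum delta)
    r^s(t), and r^(s(t) - s) absorbs R^(- sum delta) and the constants once r is below a threshold
    depending on R alone; n is chosen after that threshold. A set with r above the threshold is
    wider than every rho(u_n)^(a_i); there F(A) = A sum delta, and the proportion is of order
    (r/R)^(sum delta) <= (r/R)^s, so nothing needs to be absorbed. Only upper bounds on the number
    of balls met are used, hence R' may be any radius below half of every rho(u_n)^(a_i + t_i). *)

Lemma pred_ext (T : Type) (A B : T -> Prop) : (forall x, A x <-> B x) -> A = B.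
Proof. move=> H; apply: functional_extensionality => x; exact: propositional_extensionality. Qed.

Section FiniteFamilies.
Variable d : nat.
Implicit Types f g : 'I_d -> R.

Lemma foldr_prod_pos (l : seq 'I_d) f : (forall i, 0 < f i) ->
  0 < foldr (fun k acc => f k * acc) 1 l.
Proof. move=> H; elim: l => [|k l IH] /=; [lra | exact: Rmult_lt_0_compat]. Qed.

Lemma prodI_pos f : (forall i, 0 < f i) -> 0 < prodI f.
Proof. exact: foldr_prod_pos. Qed.

Lemma prodI_le f g : (forall i, 0 <= f i <= g i) -> prodI f <= prodI g.
Proof.
move=> H; suff [] : 0 <= prodI f <= prodI g by [].
rewrite /prodI; elim: (enum _) => [|k l [IH1 IH2]] /=; first by lra.
have [H1 H2] := H k; split; [exact: Rmult_le_pos | exact: Rmult_le_compat].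
Qed.

Lemma prodI_mult f g : prodI (fun i => f i * g i) = prodI f * prodI g.
Proof. by rewrite /prodI; elim: (enum _) => [|k l IH] /=; [|rewrite IH]; ring. Qed.

Lemma prodI_Rpower x f : prodI (fun i => Rpower x (f i)) = Rpower x (sumI f).
Proof.
rewrite /prodI /sumI; elim: (enum _) => [|k l IH] /=.
  by rewrite /Rpower Rmult_0_l exp_0.
by rewrite IH Rpower_plus.
Qed.

Lemma sumI_ext f g : (forall i, f i = g i) -> sumI f = sumI g.
Proof. by move=> H; rewrite /sumI; elim: (enum _) => [|k l IH] //=; rewrite H IH. Qed.

Lemma sumI_plus f g : sumI (fun i => f i + g i) = sumI f + sumI g.
Proof. by rewrite /sumI; elim: (enum _) => [|k l IH] /=; [|rewrite IH]; ring. Qed.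

Lemma sumI_scal c f : sumI (fun i => c * f i) = c * sumI f.
Proof. by rewrite /sumI; elim: (enum _) => [|k l IH] /=; [|rewrite IH]; ring. Qed.

Lemma sumI_ge0 f : (forall i, 0 <= f i) -> 0 <= sumI f.
Proof. move=> H; rewrite /sumI; elim: (enum _) => [|k l IH] /=; [lra | have := H k; lra]. Qed.

Lemma le_sumI f i : (forall k, 0 <= f k) -> f i <= sumI f.
Proof.
move=> H; rewrite /sumI; have : i \in enum 'I_d by rewrite mem_enum.
have H0 l : 0 <= foldr (fun k acc => f k + acc) 0 l.
  by elim: l => [|k l IH] /=; [lra | have := H k; lra].
elim: (enum _) => [|k l IH] //=; rewrite inE => /orP[/eqP <-|/IH Hi].
  by have := H0 l; lra.
by have := H k; lra.
Qed.

Lemma le_maxI f i : f i <= maxI f.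
Proof.
rewrite /maxI; have : i \in enum 'I_d by rewrite mem_enum.
elim: (enum _) => [|k l IH] //=; rewrite inE => /orP[/eqP <-|/IH Hi].
  exact: Rmax_l.
exact: Rle_trans Hi (Rmax_r _ _).
Qed.

(** Merges the thresholds of the finitely many coordinates into one; this is why several
    requirements are later expressed through a single positive real. *)
Lemma uniform_lower (P : 'I_d -> R -> Prop) :
  (forall i x y, 0 < y -> y <= x -> P i x -> P i y) ->
  (forall i, exists x, 0 < x /\ P i x) -> exists x, 0 < x /\ forall i, P i x.
Proof.
move=> Hm He.
suff [x [Hx Px]] : exists x, 0 < x /\ forall i, i \in enum 'I_d -> P i x.
  by exists x; split=> // i; apply: Px; rewrite mem_enum.
elim: (enum _) => [|k l [x [Hx Px]]]; first by exists 1; split; [lra|].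
have [y [Hy Py]] := He k.
have H0 : 0 < Rmin x y by exact: Rmin_glb_lt.
exists (Rmin x y); split=> // i; rewrite inE => /orP[/eqP ->|Hi].
  by apply: Hm Py => //; exact: Rmin_r.
by apply: Hm (Px _ Hi) => //; exact: Rmin_l.
Qed.

End FiniteFamilies.

Lemma Rpower_gt0 x y : 0 < Rpower x y.
Proof. exact: exp_pos. Qed.

Lemma Rpower_base_le x y p : 0 <= p -> 0 < x -> x <= y -> Rpower x p <= Rpower y p.
Proof. by move=> *; apply: Rle_Rpower_l. Qed.

Lemma Rpower_exp_antitone x p q : 0 < x < 1 -> p <= q -> Rpower x q <= Rpower x p.
Proof.
move=> [H0 H1] Hpq; have Hln : ln x < 0 by rewrite -ln_1; exact: ln_increasing.
have : q * ln x <= p * ln x by nra.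
by rewrite /Rpower; case=> [/exp_increasing|->]; lra.
Qed.

Lemma Rpower_small eta p : 0 < eta -> 0 < p ->
  exists x0, 0 < x0 /\ forall x, 0 < x -> x <= x0 -> Rpower x p <= eta.
Proof.
move=> He Hp; exists (Rpower eta (/ p)); split; first exact: Rpower_gt0.
move=> x Hx Hle; have := @Rpower_base_le x _ p (Rlt_le _ _ Hp) Hx Hle.
by rewrite Rpower_mult Rinv_l ?Rpower_1 //; lra.
Qed.

(** * Finite additivity on a generated sigma-algebra *)

Section Sigma.
Variables (T : Type) (G : (T -> Prop) -> Prop).
Notation S := (sigma_gen G).

Lemma sigma_or A B : S A -> S B -> S (fun x => A x \/ B x).
Proof.
move=> HA HB; have H : S (fun x => exists n, (fun n : nat => if n is O then A else B) n x).
  by apply: sg_union => -[|n].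
apply: sg_ext H _ => x; split; first by move=> [[|n]]; [left|right].
by case=> Hx; [exists O | exists 1%nat].
Qed.

Lemma sigma_and A B : S A -> S B -> S (fun x => A x /\ B x).
Proof.
move=> HA HB; have H := sg_compl (sigma_or (sg_compl HA) (sg_compl HB)).
apply: sg_ext H _ => x; split=> [H|[H1 H2]]; last by case.
by apply: NNPP => H'; apply: H; case: (classic (A x)) => HAx; [right|left] => // HBx; apply: H'.
Qed.

(** A family generated inductively from no generators is empty, so the empty set can only be reached
    from a known member. *)
Lemma sigma_False A : S A -> S (fun _ => False).
Proof. by move=> HA; apply: sg_ext (sigma_and HA (sg_compl HA)) _ => x; split=> // -[]. Qed.

Variable mu : (T -> Prop) -> R.
Hypothesis Hmu : is_measure S mu.

(** Countable additivity for the sequence A, B, empty, empty, ..., whose partial sums are constant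
    from index 1 on. *)
Lemma measure_or_disjoint A B : S A -> S B -> (forall x, A x -> B x -> False) ->
  mu (fun x => A x \/ B x) = mu A + mu B.
Proof.
move=> HA HB Hd; have [H0 [_ Hadd]] := Hmu.
pose F (n : nat) := match n with O => A | 1%nat => B | _ => fun _ => False end.
have HF n : S (F n) by case: n => [|[|n]] //=; exact: sigma_False HA.
have HFd n k x : n <> k -> F n x -> F k x -> False.
  by case: n => [|[|n]]; case: k => [|[|k]] //= _ ? ?; apply: (Hd x).
have Hs N : sum_f_R0 (fun n => mu (F n)) N.+1 = mu A + mu B.
  by elim: N => [|N IH] //; rewrite tech5 IH /= H0; ring.
have -> : (fun x => A x \/ B x) = (fun x => exists n, F n x).
  apply: pred_ext => x; split; first by case=> Hx; [exists O|exists 1%nat].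
  by move=> [[|[|n]]] //=; [left|right].
apply: UL_sequence (Hadd F HF HFd) _ => eps Heps; exists 1%nat => -[|n] Hn; first by lia.
by rewrite Hs /R_dist Rminus_diag_eq // Rabs_R0.
Qed.

Lemma measure_le A B : S A -> S B -> (forall x, A x -> B x) -> mu A <= mu B.
Proof.
move=> HA HB Hs; have HC : S (fun x => B x /\ ~ A x) by apply: sigma_and => //; exact: sg_compl.
have -> : B = (fun x => A x \/ (B x /\ ~ A x)).
  apply: pred_ext => x; split; last by case=> [/Hs|[]].
  by case: (classic (A x)); [left|right].
rewrite measure_or_disjoint //; last by move=> x ? [].
have [_ [H _]] := Hmu; have := H _ HC; lra.
Qed.

Lemma measure_or_le A B : S A -> S B -> mu (fun x => A x \/ B x) <= mu A + mu B.
Proof.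
move=> HA HB; have HC : S (fun x => B x /\ ~ A x) by apply: sigma_and => //; exact: sg_compl.
have -> : (fun x => A x \/ B x) = (fun x => A x \/ (B x /\ ~ A x)).
  apply: pred_ext => x; split; last by case=> [|[]]; [left|right].
  by case: (classic (A x)); tauto.
rewrite measure_or_disjoint //; last by move=> x ? [].
have : mu (fun x => B x /\ ~ A x) <= mu B by apply: measure_le => // x [].
lra.
Qed.
End Sigma.

Definition indic (P : Prop) : R := if excluded_middle_informative P then 1 else 0.

Lemma indicT (P : Prop) : P -> indic P = 1.
Proof. by rewrite /indic; case: (excluded_middle_informative P). Qed.

Lemma indicF (P : Prop) : ~ P -> indic P = 0.
Proof. by rewrite /indic; case: (excluded_middle_informative P). Qed.

Lemma indic_ge0 P : 0 <= indic P.
Proof. by rewrite /indic; case: (excluded_middle_informative P) => ? /=; lra. Qed.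

Fixpoint sum_list (I : Type) (f : I -> R) (s : seq I) : R :=
  if s is x :: s' then f x + sum_list f s' else 0.
Definition count_list (I : Type) (P : I -> Prop) (s : seq I) : R := sum_list (fun x => indic (P x)) s.

Lemma count_list_cons (I : Type) (P : I -> Prop) x (s : seq I) :
  count_list P (x :: s) = indic (P x) + count_list P s.
Proof. by []. Qed.

Lemma count_list_ge0 (I : Type) (P : I -> Prop) (s : seq I) : 0 <= count_list P s.
Proof. by rewrite /count_list; elim: s => [|x s IH] /=; [lra | have := indic_ge0 (P x); lra]. Qed.

Lemma sum_list_le (I : Type) (f g : I -> R) (s : seq I) :
  (forall x, List.In x s -> f x <= g x) -> sum_list f s <= sum_list g s.
Proof.
elim: s => [|x s IH] H /=; first by lra.
have H1 := H x (or_introl erefl); have H2 := IH (fun y Hy => H y (or_intror Hy)); lra.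
Qed.

Lemma sum_list_scal (I : Type) (f : I -> R) c (s : seq I) :
  sum_list (fun x => c * f x) s = c * sum_list f s.
Proof. by elim: s => [|x s IH] /=; [|rewrite IH]; ring. Qed.

Lemma sum_list_sum_f_R0 (I : Type) (f : I -> nat -> R) N (s : seq I) :
  sum_list (fun x => sum_f_R0 (f x) N) s = sum_f_R0 (fun n => sum_list (fun x => f x n) s) N.
Proof.
elim: s => [|x s IH] /=; first by elim: N => [|N IH] //=; rewrite -IH; ring.
by rewrite IH -plus_sum.
Qed.

(** * Packing, covering and averaging *)

Section Packing.
Variables (T I : Type) (G : (T -> Prop) -> Prop) (mu : (T -> Prop) -> R).
Notation S := (sigma_gen G).
Hypothesis Hmu : is_measure S mu.
Variables (A : I -> T -> Prop) (E : T -> Prop) (v : R) (P : I -> Prop).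
Hypothesis HA : forall x, S (A x).
Hypothesis HE : S E.

(** [P] selects a subfamily without changing the list, so disjointness of the whole list serves for
    every subfamily. *)
Let union s := fun p => exists x, List.In x s /\ P x /\ A x p.

Lemma unionE x s : P x -> union (x :: s) = (fun p => A x p \/ union s p).
Proof.
move=> Px; apply: pred_ext => p; split.
  by move=> [y [[<-|Hy] [Py Ay]]]; [left|right; exists y].
by move=> [Ax|[y [Hy HH]]]; [exists x|exists y]; split=> //; [left|right].
Qed.

Lemma unionNE x s : ~ P x -> union (x :: s) = union s.
Proof.
move=> Px; apply: pred_ext => p; split.
  by move=> [y [[<-|Hy] [Py Ay]]] //; exists y.
by move=> [y [Hy HH]]; exists y; split=> //; right.
Qed.

Lemma union_nil : union [::] = fun _ => False.
Proof. by apply: pred_ext => p; split=> // -[x []]. Qed.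

Lemma sigma_union s : S (union s).
Proof.
elim: s => [|x s IH]; first by rewrite union_nil; exact: sigma_False HE.
by case: (classic (P x)) => Px; [rewrite unionE //; exact: sigma_or | rewrite unionNE].
Qed.

Lemma packing_bound s : List.ForallOrdPairs (fun x y => forall p, A x p -> A y p -> False) s ->
  (forall x, List.In x s -> P x -> v <= mu (A x)) ->
  (forall x, List.In x s -> P x -> forall p, A x p -> E p) ->
  count_list P s * v <= mu E.
Proof.
move=> Hd Hv Hs; apply: (Rle_trans _ (mu (union s))); last first.
  by apply: (measure_le Hmu) => //; [exact: sigma_union | move=> p [x [Hx [Px Ax]]]; exact: Hs Ax].
elim: s Hd Hv {Hs} => [|x s IH] Hd Hv; rewrite /count_list /=.
  by rewrite union_nil; have [-> _] := Hmu; lra.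
have Hds : List.ForallOrdPairs (fun x y => forall p, A x p -> A y p -> False) s by inversion Hd.
have Hdx : forall y, List.In y s -> forall p, A x p -> A y p -> False.
  by inversion Hd; apply/List.Forall_forall.
have {IH} := IH Hds (fun y Hy => Hv y (or_intror Hy)); rewrite /count_list.
case: (classic (P x)) => Px.
  rewrite indicT // unionE // (measure_or_disjoint Hmu) //; last first.
  - by move=> p Hp [y [Hy [_ Ay]]]; exact: Hdx Ay.
  - exact: sigma_union.
  have := Hv x (or_introl erefl) Px; lra.
by rewrite indicF // unionNE //; lra.
Qed.

Lemma covering_bound s : (forall x, List.In x s -> P x -> mu (A x) <= v) ->
  (forall p, E p -> exists x, List.In x s /\ P x /\ A x p) ->
  mu E <= count_list P s * v.
Proof.
move=> Hv Hs; apply: (Rle_trans _ (mu (union s))).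
  by apply: (measure_le Hmu) => //; exact: sigma_union.
elim: s Hv {Hs} => [|x s IH] Hv; rewrite /count_list /=.
  by rewrite union_nil; have [-> _] := Hmu; lra.
have {IH} := IH (fun y Hy => Hv y (or_intror Hy)); rewrite /count_list.
case: (classic (P x)) => Px.
  rewrite indicT // unionE //.
  have := measure_or_le Hmu (HA x) (sigma_union s); have := Hv x (or_introl erefl) Px; lra.
by rewrite indicF // unionNE //; lra.
Qed.
End Packing.

(** Greedy extension: the uniform bound [N] on the size of admissible families makes it stop, and
    the induction runs on the room [N - size s] still left. *)
Lemma maximal_family (I : Type) (C : I -> Prop) (disj : I -> I -> Prop) (N : nat) :
  (forall s, List.Forall C s -> List.ForallOrdPairs disj s -> (size s <= N)%nat) ->
  exists s, List.Forall C s /\ List.ForallOrdPairs disj s /\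
    forall x, C x -> exists y, List.In y s /\ ~ disj x y.
Proof.
move=> HN.
suff H k : forall s, List.Forall C s -> List.ForallOrdPairs disj s -> (N - size s <= k)%nat ->
   exists s, List.Forall C s /\ List.ForallOrdPairs disj s /\
    forall x, C x -> exists y, List.In y s /\ ~ disj x y.
  by apply: (H N [::]); [constructor|constructor|exact: leq_subr].
elim: k => [|k IH] s Hs Hd Hk.
all: case: (classic (exists x, C x /\ forall y, List.In y s -> disj x y)) => [[x [Cx Dx]]|Hn];
  last by [exists s; split=> //; split=> // x Cx; apply: NNPP => Hx; apply: Hn;
    exists x; split=> // y Hy; apply: NNPP => Hxy; apply: Hx; exists y].
all: have Hs' : List.Forall C (x :: s) by constructor.
all: have Hd' : List.ForallOrdPairs disj (x :: s) by constructor=> //; apply/List.Forall_forall.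
  by have := HN _ Hs' Hd'; move: Hk; rewrite leqn0 subn_eq0 /= => /leq_ltn_trans H /H; rewrite ltnn.
apply: (IH (x :: s)) => //=; rewrite subnS.
by move: Hk; case: (N - size s)%nat.
Qed.

(** If every [x] failed, each would fail from some index on, partial sums of nonnegative terms being
    monotone. A finite list has a common such index, and there the total exceeds the number of
    elements. *)
Lemma averaging (I : Type) (s : seq I) (phi : I -> nat -> R) :
  (forall x n, 0 <= phi x n) -> 0 < count_list (fun _ => True) s ->
  (forall N, sum_f_R0 (fun n => sum_list (fun x => phi x n) s) N <= count_list (fun _ => True) s) ->
  exists x, List.In x s /\ forall N, sum_f_R0 (phi x) N <= 1.
Proof.
move=> H0 Hne Hs; apply: NNPP => Hn.
have Hx x : List.In x s -> exists N, forall M, (N <= M)%coq_nat -> 1 < sum_f_R0 (phi x) M.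
  move=> Hx; apply: NNPP => H; apply: Hn; exists x; split=> // N; apply: Rnot_lt_le => HN.
  apply: H; exists N => M; elim: M / => [|M HM IH] //=; have := H0 x M.+1; lra.
have [N HN] : exists N, forall x, List.In x s -> 1 < sum_f_R0 (phi x) N.
  suff [N HN] : exists N, forall x, List.In x s -> forall M, (N <= M)%coq_nat -> 1 < sum_f_R0 (phi x) M.
    by exists N => x Hxs; exact: HN.
  elim: s Hx {Hn Hne Hs} => [|x s IH] Hx; first by exists O.
  have [N HN] := IH (fun y Hy => Hx y (or_intror Hy)); have [M HM] := Hx x (or_introl erefl).
  exists (N + M)%coq_nat => y [<-|Hy] k Hk; [apply: HM | apply: HN => //]; lia.
have := Hs N; rewrite -sum_list_sum_f_R0.
suff : sum_list (fun x => sum_f_R0 (phi x) N) s > count_list (fun _ => True) s by lra.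
elim: s Hne HN {Hn Hs Hx} => [|x s IH]; first by rewrite /count_list /=; lra.
rewrite !count_list_cons indicT // => _ HN /=; have := HN x (or_introl erefl).
case: s IH HN => [|y s] IH HN; first by rewrite /count_list /=; lra.
have /IH : 0 < count_list (fun _ => True) (y :: s).
  by rewrite count_list_cons indicT //; have := count_list_ge0 (fun _ : I => True) s; lra.
by move=> /(_ (fun z Hz => HN z (or_intror Hz))) /=; lra.
Qed.

(** * Coordinate estimates *)

Section MetricSpace.
Variables (T : Type) (dist : T -> T -> R).
Hypothesis Hd : is_metric dist.

Lemma dist_sym x y : dist x y = dist y x.
Proof. by have [_ [_ [H _]]] := Hd. Qed.

Lemma dist_tri x y z : dist x z <= dist x y + dist y z.
Proof. by have [_ [_ [_ H]]] := Hd. Qed.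

Lemma dist_refl x : dist x x = 0.
Proof. by have [_ [H _]] := Hd; apply/H. Qed.

Lemma open_ball x r : open_set dist (ball dist x r).
Proof.
move=> y Hy; exists (r - dist x y); rewrite /ball in Hy *; split; first by lra.
by move=> z Hz; have := dist_tri x y z; lra.
Qed.

Lemma open_Delta E r : open_set dist (Delta dist E r).
Proof.
move=> y [z [Ez Hz]]; exists (r - dist y z); split; first by lra.
move=> p; rewrite /ball => Hp; exists z; split=> //.
by have := dist_tri p y z; have := dist_sym p y; lra.
Qed.

Lemma open_and A B : open_set dist A -> open_set dist B -> open_set dist (fun x => A x /\ B x).
Proof.
move=> HA HB x [/HA [r [Hr Ar]] /HB [r' [Hr' Br']]].
exists (Rmin r r'); split; first exact: Rmin_glb_lt.
move=> y Hy; split; [apply: Ar | apply: Br']; apply: Rlt_le_trans Hy _; [exact: Rmin_l|exact: Rmin_r].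
Qed.

End MetricSpace.

(** Up to constants, the measure of the [eps]-neighbourhood of a resonant set inside a ball of
    radius [r] centred on that set. *)
Definition scale_vol (delta kappa r eps : R) : R :=
  Rpower r (delta * kappa) * Rpower eps (delta * (1 - kappa)).

Lemma scale_vol_gt0 delta kappa r eps : 0 < scale_vol delta kappa r eps.
Proof. by apply: Rmult_lt_0_compat; exact: Rpower_gt0. Qed.

(* Regularity and scaling with the numerical factors used later absorbed in a single constant [K]. *)
Definition regular_scaling (J T : Type) (dist : T -> T -> R) (mu : (T -> Prop) -> R)
    (E : J -> T -> Prop) (delta kappa K r0 : R) : Prop :=
  (forall x r, 0 < r <= r0 -> Rpower r delta <= K * mu (ball dist x (r / 4))) /\
  (forall x r, 0 < r <= r0 -> mu (ball dist x (7 * r)) <= K * Rpower r delta) /\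
  (forall al x r h, E al x -> 0 < h < r -> r <= r0 ->
     scale_vol delta kappa r h <=
       K * mu (fun y => ball dist x (r / 2) y /\ Delta dist (E al) (h / 2) y)) /\
  (forall al x r h, E al x -> 0 < h <= r -> r <= r0 ->
     mu (fun y => ball dist x (7 * r) y /\ Delta dist (E al) h y) <= K * scale_vol delta kappa r h).

Section Coordinate.
Variables (J T : Type) (dist : T -> T -> R) (mu : (T -> Prop) -> R) (E : J -> T -> Prop).
Variables (delta kappa : R).
Hypothesis Hd : is_metric dist.
Hypothesis Hmu : is_measure (borel dist) mu.

Lemma mu_ge0 A : open_set dist A -> 0 <= mu A.
Proof. by move=> HA; have [_ [H _]] := Hmu; apply: H; exact: sg_base. Qed.

Lemma mu_le A B : open_set dist A -> open_set dist B -> (forall x, A x -> B x) -> mu A <= mu B.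
Proof. by move=> HA HB; apply: (measure_le Hmu); exact: sg_base. Qed.

(** Allows all coordinates to share one pair of constants. *)
Lemma regular_scaling_mono K K' r0 r0' : K <= K' -> r0' <= r0 ->
  regular_scaling dist mu E delta kappa K r0 -> regular_scaling dist mu E delta kappa K' r0'.
Proof.
move=> HK Hr [H1 [H2 [H3 H4]]]; split; [|split; [|split]].
- move=> x r Hr'; apply: Rle_trans (H1 x r _) _; first by lra.
  by apply: Rmult_le_compat_r => //; apply: mu_ge0; exact: open_ball.
- move=> x r Hr'; apply: Rle_trans (H2 x r _) _; first by lra.
  by apply: Rmult_le_compat_r => //; exact: Rlt_le (Rpower_gt0 _ _).
- move=> al x r h Ex Hh Hr'; apply: Rle_trans (H3 al x r h Ex Hh _) _; first by lra.
  by apply: Rmult_le_compat_r => //; apply: mu_ge0; apply: open_and; [exact: open_ball | exact: open_Delta].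
- move=> al x r h Ex Hh Hr'; apply: Rle_trans (H4 al x r h Ex Hh _) _; first by lra.
  by apply: Rmult_le_compat_r => //; exact: Rlt_le (scale_vol_gt0 _ _ _ _).
Qed.

Lemma regular_scaling_exists :
  ahlfors_regular dist mu delta -> kappa_scaling dist mu delta kappa E ->
  exists K r0, 0 < K /\ 0 < r0 /\ regular_scaling dist mu E delta kappa K r0.
Proof.
move=> [c [C [r0 [Hc [HC [Hr0 HA]]]]]] [c2 [c3 [r1 [Hc2 [Hc3 [Hr1 HK]]]]]].
pose K1 := Rpower 4 delta / c; pose K2 := C * Rpower 7 delta.
pose K3 := Rpower 2 (delta * kappa) * Rpower 2 (delta * (1 - kappa)) / c2.
pose K4 := c3 * Rpower 7 (delta * kappa).
have P x y := Rpower_gt0 x y.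
have HK1 : 0 < K1 by apply: Rdiv_lt_0_compat.
have HK2 : 0 < K2 by apply: Rmult_lt_0_compat.
have HK3 : 0 < K3 by apply: Rdiv_lt_0_compat => //; apply: Rmult_lt_0_compat.
have HK4 : 0 < K4 by apply: Rmult_lt_0_compat.
(* Radius 7 r must be at most [r0] for regularity and strictly below [r1] for scaling, hence 7 and
   8. *)
have Hs1 := Rmin_l (r0 / 7) (r1 / 8); have Hs2 := Rmin_r (r0 / 7) (r1 / 8).
have Hs0 : 0 < Rmin (r0 / 7) (r1 / 8) by apply: Rmin_glb_lt; lra.
exists (K1 + K2 + K3 + K4), (Rmin (r0 / 7) (r1 / 8)); split; first by lra.
split=> //; split; [|split; [|split]].
- move=> x r Hr; have [H1 _] := HA x (r / 4) ltac:(lra).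
  have -> : r = 4 * (r / 4) by field.
  rewrite -(Rpower_mult_distr 4 (r / 4)); [|lra|lra]; have -> : 4 * (r / 4) / 4 = r / 4 by field.
  have HX : 0 <= mu (ball dist x (r / 4)) by apply: mu_ge0; exact: open_ball.
  apply: (Rle_trans _ (K1 * mu (ball dist x (r / 4)))); last by nra.
  have -> : Rpower 4 delta * Rpower (r / 4) delta = K1 * (c * Rpower (r / 4) delta).
    by rewrite /K1; field; lra.
  by apply: Rmult_le_compat_l => //; lra.
- move=> x r Hr; have [_ H1] := HA x (7 * r) ltac:(lra).
  apply: Rle_trans H1 _; rewrite -Rpower_mult_distr; [|lra|lra]; rewrite -Rmult_assoc -/K2.
  by apply: Rmult_le_compat_r; [exact: Rlt_le | lra].
- move=> al x r h Ex Hh Hr; have [H1 _] := HK al x (h / 2) (r / 2) Ex ltac:(lra) ltac:(lra) ltac:(lra).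
  set X := mu _ in H1 *.
  have -> : scale_vol delta kappa r h =
      K3 * (c2 * Rpower (r / 2) (delta * kappa) * Rpower (h / 2) (delta * (1 - kappa))).
    rewrite /scale_vol {1}(_ : r = 2 * (r / 2)); last by field.
    rewrite {1}(_ : h = 2 * (h / 2)); last by field.
    rewrite -(Rpower_mult_distr 2 (r / 2)); [|lra|lra].
    rewrite -(Rpower_mult_distr 2 (h / 2)); [|lra|lra].
    by rewrite /K3; field; lra.
  have HX : 0 <= X by apply: mu_ge0; apply: open_and; [exact: open_ball | exact: open_Delta].
  apply: (Rle_trans _ (K3 * X)); last by nra.
  by apply: Rmult_le_compat_l => //; lra.
- move=> al x r h Ex Hh Hr; have [_ H1] := HK al x h (7 * r) Ex ltac:(lra) ltac:(lra) ltac:(lra).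
  apply: Rle_trans H1 _; rewrite -Rpower_mult_distr; [|lra|lra].
  have -> : c3 * (Rpower 7 (delta * kappa) * Rpower r (delta * kappa)) * Rpower h (delta * (1 - kappa))
     = K4 * scale_vol delta kappa r h by rewrite /K4 /scale_vol; ring.
  by apply: Rmult_le_compat_r; [exact: Rlt_le (scale_vol_gt0 _ _ _ _) | lra].
Qed.
End Coordinate.

(* For [r = rho ^ A], the contribution of one coordinate to the exponent of the bound on the
   proportion of children meeting a ball of radius [r]; see [neighbourhood_bound]. *)
Definition coord_exponent (delta kappa a t A : R) : R :=
  delta * (A - (1 - kappa) * Rmax 0 (Rmin (A - a) t)).

Lemma coord_exponent_low delta kappa a t A : 0 < t -> A <= a ->
  coord_exponent delta kappa a t A = delta * A.
Proof.
move=> Ht H; rewrite /coord_exponent Rmax_left; first by ring.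
by apply: Rle_trans (Rmin_l _ _) _; lra.
Qed.

Lemma coord_exponent_mid delta kappa a t A : a <= A <= a + t ->
  coord_exponent delta kappa a t A = delta * (A - (1 - kappa) * (A - a)).
Proof. by move=> H; rewrite /coord_exponent Rmin_left ?Rmax_right //; lra. Qed.

Lemma coord_exponent_high delta kappa a t A : 0 < t -> a + t <= A ->
  coord_exponent delta kappa a t A = delta * (A - (1 - kappa) * t).
Proof. by move=> Ht H; rewrite /coord_exponent Rmin_right ?Rmax_right //; lra. Qed.

Section CoordinateBound.
Variables (J T : Type) (dist : T -> T -> R) (mu : (T -> Prop) -> R) (E : J -> T -> Prop).
Variables (delta kappa K r0 : R).
Hypothesis Hd : is_metric dist.
Hypothesis Hmu : is_measure (borel dist) mu.
Hypothesis HE : regular_scaling dist mu E delta kappa K r0.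

(** Write r, e, h for the powers of [rho] with exponents A, a, a + t. For r >= e the small ball is
    ignored, for r <= h the neighbourhood is ignored, and in between scaling is applied at radius
    comparable to r. The factor with [Rmax] stands for the volume in which the boxes of side e
    meeting the small ball are spread; including it gives all three cases one form. *)
Lemma neighbourhood_bound (al : J) (z x0 : T) (rho a t A : R) :
  E al z -> 0 < K -> 0 < rho < 1 -> 0 < t -> Rpower rho a <= r0 -> Rpower rho A <= r0 ->
  mu (fun y => ball dist z (Rpower rho a) y /\ Delta dist (E al) (Rpower rho (a + t)) y /\
               ball dist x0 (3 * Rpower rho A) y)
    * Rpower (Rmax (Rpower rho A) (Rpower rho a)) delta
  <= K * scale_vol delta kappa (Rpower rho a) (Rpower rho (a + t)) *
     Rpower rho (coord_exponent delta kappa a t A).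
Proof.
move=> Ez HK Hrho Ht He Hr.
have [_ [HA [_ HS]]] := HE.
set e := Rpower rho a in He *; set h := Rpower rho (a + t); set r := Rpower rho A in Hr *.
have He0 : 0 < e by exact: Rpower_gt0.
have Hh0 : 0 < h by exact: Rpower_gt0.
have Hr0 : 0 < r by exact: Rpower_gt0.
have Hhe : h <= e by apply: Rpower_exp_antitone => //; lra.
set X := (fun y : T => _).
have HX : open_set dist X.
  by apply: open_and; [exact: open_ball | apply: open_and; [exact: open_Delta | exact: open_ball]].
have HX0 : 0 <= mu X by exact: (mu_ge0 Hmu).
have key V : 0 < V -> mu X <= K * V ->
    V * Rpower (Rmax r e) delta =
      scale_vol delta kappa e h * Rpower rho (coord_exponent delta kappa a t A) ->
    mu X * Rpower (Rmax r e) delta <=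
      K * scale_vol delta kappa e h * Rpower rho (coord_exponent delta kappa a t A).
  move=> HV H1 H2; rewrite [in X in _ <= X]Rmult_assoc -H2 -Rmult_assoc.
  by apply: Rmult_le_compat_r => //; exact: Rlt_le (Rpower_gt0 _ _).
case: (Rle_dec A a) => HAa.
  have Hre : e <= r by exact: Rpower_exp_antitone.
  apply: (key (scale_vol delta kappa e h)); first exact: scale_vol_gt0.
  - apply: Rle_trans (HS al z e h Ez ltac:(lra) He); apply: (mu_le Hmu) => //.
      by apply: open_and; [exact: open_ball | exact: open_Delta].
    by move=> y [Hy [Hy' _]]; split=> //; rewrite /ball in Hy *; lra.
  - by rewrite Rmax_left // coord_exponent_low // /r Rpower_mult (Rmult_comm A).
have Hre : r <= e by apply: Rpower_exp_antitone => //; lra.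
rewrite Rmax_right // in key *.
case: (Rle_dec (a + t) A) => HAt.
  have Hrh : r <= h by exact: Rpower_exp_antitone.
  apply: (key (Rpower r delta)); first exact: Rpower_gt0.
  - apply: Rle_trans (HA x0 r ltac:(lra)); apply: (mu_le Hmu) => //; first exact: open_ball.
    by move=> y [_ [_ Hy]]; rewrite /ball in Hy *; lra.
  - rewrite coord_exponent_high // /scale_vol /r /e /h !Rpower_mult -!Rpower_plus; congr (Rpower _ _); ring.
have Hrh : h <= r by apply: Rpower_exp_antitone => //; lra.
apply: (key (scale_vol delta kappa r h)); first exact: scale_vol_gt0.
(* Scaling needs a centre in the resonant set, while [x0] is arbitrary. A point of the trace has
   some [q] of that set within h, and h + 3 r + 3 r <= 7 r: the origin of the factor 7. An empty
   trace has measure 0. *)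
- case: (classic (exists p, X p)) => [[p [_ [[q [Eq Hpq]] Hp]]]|Hn]; last first.
    have -> : X = fun _ => False by apply: pred_ext => y; split=> // Hy; apply: Hn; exists y.
    by have [-> _] := Hmu; apply: Rmult_le_pos; [lra | exact: Rlt_le (scale_vol_gt0 _ _ _ _)].
  apply: Rle_trans (HS al q r h Eq ltac:(lra) Hr); apply: (mu_le Hmu) => //.
    by apply: open_and; [exact: open_ball | exact: open_Delta].
  move=> y [_ [Hy Hy']]; split=> //; rewrite /ball in Hy' Hp *.
  have := dist_tri Hd q p y; have := dist_tri Hd p x0 y;
  have := dist_sym Hd p q; have := dist_sym Hd x0 p; lra.
- rewrite coord_exponent_mid; last by lra.
  rewrite /scale_vol /r /e /h !Rpower_mult -!Rpower_plus; congr (Rpower _ _); ring.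
Qed.
End CoordinateBound.

(** * The dimensional number *)

Lemma min_list_map_le (f : R -> R) (s : seq R) x : List.In x s -> min_list (map f s) <= f x.
Proof.
case: s => [|y s] //= Hx.
have Hy : foldr Rmin (f y) (map f s) <= f y.
  by elim: s {Hx} => [|z s IH] /=; [lra | apply: Rle_trans (Rmin_r _ _) IH].
case: Hx => [<-|] //; elim: s {Hy} => [|z s IH] //= [->|/IH H]; first exact: Rmin_l.
exact: Rle_trans (Rmin_r _ _) H.
Qed.

(** When no candidate lies below [A], 0 serves as left breakpoint, because the exponent vanishes
    there. *)
Lemma exists_lower_neighbour (s : seq R) A : 0 <= A ->
  exists lo, (lo = 0 \/ List.In lo s) /\ 0 <= lo <= A /\ forall p, List.In p s -> p <= A -> p <= lo.
Proof.
move=> HA; elim: s => [|x s [lo [H1 [H2 H3]]]]; first by exists 0; split; [left|split; [lra|]].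
case: (Rle_dec x A) => HxA; last first.
  exists lo; split; first by case: H1; [left|right; right].
  by split=> // p [<- //|]; exact: H3.
case: (Rle_dec lo x) => Hx.
  exists x; split; first by right; left.
  by split; [lra|] => p [<- ?|Hp HpA]; [lra | have := H3 p Hp HpA; lra].
exists lo; split; first by case: H1; [left|right; right].
by split=> // p [<- ?|]; [lra | exact: H3].
Qed.

Lemma exists_upper_neighbour (s : seq R) A :
  (forall p, List.In p s -> p < A) \/
  exists hi, List.In hi s /\ A <= hi /\ forall p, List.In p s -> A <= p -> hi <= p.
Proof.
elim: s => [|x s IH]; first by left.
case: (Rlt_le_dec x A) => HxA.
  case: IH => [IH|[hi [H1 [H2 H3]]]]; first by left=> p [<-|/IH] //; lra.
  right; exists hi; split; first by right.
  by split=> // p [<- ?|]; [lra|exact: H3].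
right; case: IH => [IH|[hi [H1 [H2 H3]]]].
  exists x; split; first by left.
  by split; [lra|] => p [<- ?|/IH ? ?]; lra.
case: (Rle_dec x hi) => Hx.
  exists x; split; first by left.
  by split; [lra|] => p [<- ?|Hp Hp']; [lra | have := H3 p Hp Hp'; lra].
exists hi; split; first by right.
by split=> // p [<- ?|]; [lra | exact: H3].
Qed.

(** The last two hypotheses keep the breakpoints a and a + t out of the open interval, so a single
    affine formula is valid at lo, A and hi. Without division, lo = hi is harmless. *)
Lemma coord_exponent_affine delta kappa a t lo hi A :
  0 < t -> lo <= A <= hi -> a <= lo \/ hi <= a -> a + t <= lo \/ hi <= a + t ->
  (hi - lo) * coord_exponent delta kappa a t A =
  (hi - A) * coord_exponent delta kappa a t lo + (A - lo) * coord_exponent delta kappa a t hi.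
Proof.
move=> Ht HA [H1|H1] [H2|H2]; try by (exfalso; lra).
- by rewrite !coord_exponent_high; try lra; ring.
- by rewrite !coord_exponent_mid; try lra; ring.
- by rewrite !coord_exponent_low; try lra; ring.
Qed.

Section DimensionalNumber.
Variables (d : nat) (delta a t : 'I_d -> R) (kappa : R).
Hypothesis Hd : (0 < d)%N.
Hypothesis Hdelta : forall i, 0 < delta i.
Hypothesis Ha : forall i, 0 < a i.
Hypothesis Ht : forall i, 0 < t i.
Hypothesis Hkappa : 0 <= kappa < 1.

Let F A := sumI (fun k => coord_exponent (delta k) kappa (a k) (t k) A).
Let sd := s_dim delta a t kappa.

(** The sets K1, K3, K2 are exactly the ranges A <= a, a < A < a + t, a + t <= A of
    [coord_exponent]; the identity then holds coordinate by coordinate. *)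
Lemma s_term_exponent A : 0 < A -> A * s_term delta a t kappa A = F A.
Proof.
move=> HA; rewrite /s_term /F.
set f1 := (fun k => if inK1 _ _ _ then _ else _); set f2 := (fun k => if inK2 _ _ _ _ then delta k else _).
set f3 := (fun k => if inK3 _ _ _ _ then delta k else _); set f4 := (fun k => if inK3 _ _ _ _ then _ else _).
set f5 := (fun k => if inK2 _ _ _ _ then _ else _).
transitivity (sumI (fun k => A * f1 k + (A * f2 k + (A * kappa * f3 k +
  ((1 - kappa) * f4 k + (- (1 - kappa)) * f5 k))))).
  by rewrite !sumI_plus !sumI_scal; field; lra.
apply: sumI_ext => k; rewrite /f1 /f2 /f3 /f4 /f5 /inK3 /inK2 /inK1.
have Htk := Ht k.
case: (Rle_dec A (a k)) => H1 /=.
  by rewrite andbF /= coord_exponent_low //; ring.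
case: (Rle_dec (a k + t k) A) => H2 /=.
  by rewrite coord_exponent_high //; ring.
by rewrite coord_exponent_mid; [ring | lra].
Qed.

Lemma dim_candidatesP p :
  List.In p (dim_candidates a t) <-> exists k, p = a k \/ p = a k + t k.
Proof.
rewrite /dim_candidates; split.
  elim: (enum _) => [|k s IH] //= [<-|[<-|]] //; [by exists k; left | by exists k; right].
move=> [k Hk]; have : k \in enum 'I_d by rewrite mem_enum.
elim: (enum _) => [|j s IH] //=; rewrite inE => /orP[/eqP <-|/IH]; last by right; right.
by case: Hk => ->; [left|right; left].
Qed.

Lemma dim_candidates_gt0 p : List.In p (dim_candidates a t) -> 0 < p.
Proof. by move=> /dim_candidatesP [k [->|->]]; have := Ha k; have := Ht k; lra. Qed.

Lemma s_dim_candidate p : List.In p (dim_candidates a t) -> sd * p <= F p.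
Proof.
move=> Hp; have Hp0 := dim_candidates_gt0 Hp.
rewrite -s_term_exponent // Rmult_comm; apply: Rmult_le_compat_l; first by lra.
exact: min_list_map_le.
Qed.

(** Each coordinate exponent is at most [delta * A], so any one candidate gives the bound. It
    controls the last affine piece of [F] and makes D - s positive in the descent. *)
Lemma s_dim_le_sum : sd <= sumI delta.
Proof.
pose k := Ordinal Hd; have Hk := Ha k.
have H : sd * a k <= F (a k) by apply: s_dim_candidate; apply/dim_candidatesP; exists k; left.
suff : F (a k) <= sumI delta * a k by nra.
rewrite Rmult_comm -sumI_scal.
suff : 0 <= sumI (fun i => a k * delta i + -1 * coord_exponent (delta i) kappa (a i) (t i) (a k)).
  by rewrite sumI_plus (sumI_scal (-1)) -/(F (a k)); lra.
apply: sumI_ge0 => i; rewrite /coord_exponent.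
have := Rmax_l 0 (Rmin (a k - a i) (t i)); set M := Rmax _ _ => HM.
have : 0 <= delta i * ((1 - kappa) * M).
  by apply: Rmult_le_pos; [exact: Rlt_le | apply: Rmult_le_pos => //; lra].
lra.
Qed.

(* [F] is piecewise affine with breakpoints at the candidates, so the bounds there propagate. *)
Lemma s_dim_le_exponent A : 0 <= A -> sd * A <= F A.
Proof.
move=> HA; have [lo [Hlo [Hlo0 Hlom]]] := exists_lower_neighbour (dim_candidates a t) HA.
have Flo : sd * lo <= F lo.
  case: Hlo => [->|]; last exact: s_dim_candidate.
  suff -> : F 0 = 0 by lra.
  rewrite /F (@sumI_ext _ _ (fun k => 0 * delta k)) ?sumI_scal; first by ring.
  by move=> k; rewrite coord_exponent_low ?Rmult_0_r ?Rmult_0_l //; exact: Rlt_le.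
have Hak k : List.In (a k) (dim_candidates a t) by apply/dim_candidatesP; exists k; left.
have Hatk k : List.In (a k + t k) (dim_candidates a t) by apply/dim_candidatesP; exists k; right.
case: (exists_upper_neighbour (dim_candidates a t) A) => [Hall|[hi [Hhi [HAhi Hhim]]]].
  (* Past the last candidate every coordinate has slope [delta]. *)
  suff -> : F A = F lo + (A - lo) * sumI delta.
    by have := s_dim_le_sum; nra.
  rewrite -sumI_scal -sumI_plus; apply: sumI_ext => k.
  have H1 := Rlt_le _ _ (Hall _ (Hatk k)); have H2 := Hlom _ (Hatk k) H1.
  by rewrite !coord_exponent_high //; ring.
have Fhi := s_dim_candidate Hhi.
have Haff : (hi - lo) * F A = (hi - A) * F lo + (A - lo) * F hi.
  rewrite -!sumI_scal -sumI_plus; apply: sumI_ext => k; apply: coord_exponent_affine => //; first by lra.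
    by case: (Rle_dec (a k) A) => H; [left; exact: Hlom | right; apply: Hhim => //; lra].
  by case: (Rle_dec (a k + t k) A) => H; [left; exact: Hlom | right; apply: Hhim => //; lra].
case: (Rle_lt_dec hi lo) => Hc.
  by have -> : A = lo by lra.
apply: (Rmult_le_reg_l (hi - lo)); first by lra.
rewrite Haff; have : (hi - A) * (sd * lo) <= (hi - A) * F lo by apply: Rmult_le_compat_l; lra.
have : (A - lo) * (sd * hi) <= (A - lo) * F hi by apply: Rmult_le_compat_l; lra.
lra.
Qed.
End DimensionalNumber.

(** * Children of a ball *)

(** Eliminates the number [nZ] of boxes, the number [z0] of boxes met, and all volumes. The eight
    powers of [PK] are two from each of the first, second and fourth estimates, one from the third
    and one from the final identity. *)
Lemma proportion_algebra (PK PKi cB Pd Pe Pv PR Pw Pm Pf y0 z0 nY nZ : R) :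
  0 < PK -> PK * PKi = 1 -> 0 < cB -> 0 < Pe -> 0 < Pv -> 0 < PR -> 0 < Pw -> 0 < Pd -> 0 <= y0 ->
  cB * (PKi * Pd) <= nZ * (PK * Pe) -> nZ * (PKi * Pv) <= nY * (PK * PR) ->
  y0 * (PKi * PR) <= z0 * Pw -> z0 * (PKi * Pe) <= PK * Pm -> Pw * Pm = PK * Pv * Pf ->
  y0 * Pd <= PK ^ 8 / cB * Pf * nY.
Proof.
move=> HPK HPKi HcB HPe HPv HPR HPw HPd Hy I1 I2 I3 I4 I5.
have mulK u v : u <= v -> PK * u <= PK * v by move=> H; apply: Rmult_le_compat_l => //; lra.
have {}I1 := mulK _ _ I1; have {}I2 := mulK _ _ I2; have {}I3 := mulK _ _ I3; have {}I4 := mulK _ _ I4.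
have rewK u v : PK * (u * (PKi * v)) = u * v by rewrite -[u * v]Rmult_1_l -HPKi; ring.
rewrite !rewK in I1 I2 I3 I4.
have IA : y0 * PR * Pe <= PK ^ 4 * (Pv * Pf).
  have -> : PK ^ 4 * (Pv * Pf) = PK * Pw * (PK * (PK * Pm)).
    by transitivity (PK ^ 3 * (Pw * Pm)); [rewrite I5|]; ring.
  apply: (Rle_trans _ (PK * Pw * (z0 * Pe))); last first.
    by apply: Rmult_le_compat_l => //; apply: Rmult_le_pos; lra.
  have -> : PK * Pw * (z0 * Pe) = PK * (z0 * Pw) * Pe by ring.
  by apply: Rmult_le_compat_r => //; lra.
have IB : cB * Pd * Pv <= PK ^ 4 * nY * PR * Pe.
  have -> : PK ^ 4 * nY * PR * Pe = PK ^ 2 * Pe * (PK * (nY * (PK * PR))) by ring.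
  apply: (Rle_trans _ (PK ^ 2 * Pe * (nZ * Pv))); last first.
    by apply: Rmult_le_compat_l => //; apply: Rmult_le_pos; [apply: pow_le|]; lra.
  have -> : PK ^ 2 * Pe * (nZ * Pv) = PK * (nZ * (PK * Pe)) * Pv by ring.
  by apply: Rmult_le_compat_r => //; lra.
have IC : (y0 * PR * Pe) * (cB * Pd * Pv) <= (PK ^ 4 * (Pv * Pf)) * (PK ^ 4 * nY * PR * Pe).
  by apply: Rmult_le_compat => //; repeat apply: Rmult_le_pos => //; lra.
apply: (Rmult_le_reg_l (PR * Pe * Pv * cB)).
  by repeat apply: Rmult_lt_0_compat => //.
apply: Rle_trans (Rle_trans _ _ _ _ IC) _; last by apply: Req_le; field; lra.
by apply: Req_le; ring.
Qed.

Section ProductSpace.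
Variables (d : nat) (T : 'I_d -> Type) (dist : forall i, T i -> T i -> R).
Arguments dist : clear implicits.
Variables (mi : forall i, (T i -> Prop) -> R) (m : (PX T -> Prop) -> R).
Arguments mi : clear implicits.
Hypothesis Hmetric : forall i, is_metric (dist i).
Hypothesis Hmi : forall i, is_measure (borel (dist i)) (mi i).
Hypothesis Hm : is_product_measure dist mi m.

Definition open_box (A : forall i, T i -> Prop) : Prop := forall i, open_set (dist i) (A i).

Lemma open_box_sigma A : open_box A -> prod_sigma dist (rectangle A).
Proof. by move=> HA; apply: sg_base; exists A; split=> // i; exact: sg_base. Qed.

Lemma open_box_measure A : open_box A -> m (rectangle A) = prodI (fun i => mi i (A i)).
Proof. by move=> HA; have [_ H] := Hm; apply: H => i; exact: sg_base. Qed.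

Lemma open_box_measure_ge A f : open_box A -> (forall i, 0 < f i <= mi i (A i)) ->
  prodI f <= m (rectangle A).
Proof. by move=> HA H; rewrite open_box_measure //; apply: prodI_le => i; have := H i; lra. Qed.

Lemma open_box_measure_le A f : open_box A -> (forall i, mi i (A i) <= f i) ->
  m (rectangle A) <= prodI f.
Proof.
move=> HA H; rewrite open_box_measure //; apply: prodI_le => i; split=> //.
exact: (mu_ge0 (Hmi i)).
Qed.

(** The total measure is finite, so at most m(X) / v disjoint boxes of measure at least v exist; the
    whole space is written as a box to make it measurable. *)
Lemma maximal_disjoint_boxes (I : Type) (C : I -> Prop) (A : I -> forall i, T i -> Prop) v :
  (forall x, open_box (A x)) -> 0 < v -> (forall x, C x -> v <= m (rectangle (A x))) ->
  exists s, List.Forall C s /\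
    List.ForallOrdPairs (fun x y => forall p, rectangle (A x) p -> rectangle (A y) p -> False) s /\
    forall x, C x -> exists y, List.In y s /\ exists p, rectangle (A x) p /\ rectangle (A y) p.
Proof.
move=> HA Hv HC; pose E : PX T -> Prop := rectangle (fun i _ => True).
have HE : prod_sigma dist E by apply: open_box_sigma => i x _; exists 1; split; [lra|].
have [N HN] := INR_unbounded (m E / v).
have [s [H1 [H2 H3]]] : exists s, List.Forall C s /\
    List.ForallOrdPairs (fun x y => forall p, rectangle (A x) p -> rectangle (A y) p -> False) s /\
    forall x, C x -> exists y, List.In y s /\
      ~ (forall p, rectangle (A x) p -> rectangle (A y) p -> False).
  apply: (maximal_family (N := N)) => s Hs Hd.
  have H := packing_bound (proj1 Hm) (P := fun _ => True) (fun x => open_box_sigma (HA x)) HE Hd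
    (fun x Hx _ => HC x (proj1 (List.Forall_forall _ _) Hs x Hx)) (fun _ _ _ _ _ _ => Logic.I).
  have Hc : count_list (fun _ => True) s = INR (size s).
    elim: (s) => [|x s' IH] //; rewrite count_list_cons indicT // IH [size (x :: s')]/= S_INR; ring.
  rewrite Hc in H; apply/leP/INR_le/Rlt_le/(Rle_lt_trans _ (m E / v)) => //.
  apply: (Rmult_le_reg_r v) => //; have -> : m E / v * v = m E by field; lra.
  exact: H.
exists s; split=> //; split=> // x /H3 [y [Hy Hn]]; exists y; split=> //.
by apply: NNPP => H; apply: Hn => p H4 H5; apply: H; exists p.
Qed.

Variables (J : Type) (Rs : J -> forall i, T i -> Prop).
Arguments Rs : clear implicits.
Variables (delta a t : 'I_d -> R) (kappa K r0 : R).
Hypothesis HK : 0 < K.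
Hypothesis Ht : forall i, 0 < t i.
Hypothesis Hreg : forall i,
  regular_scaling (dist i) (mi i) (fun al => Rs al i) (delta i) kappa K r0.

Section Generation.
Variables (x : PX T) (rad rho R' cB : R) (Jp : J -> Prop).
Hypothesis Hrad : 0 < rad <= r0.
Hypothesis Hrho : 0 < rho < 1.
Hypothesis HR' : 0 < R'.
Hypothesis HcB : 0 < cB.
Let e i := Rpower rho (a i).
Let h i := Rpower rho (a i + t i).
Hypothesis He : forall i, e i <= rad / 8.
Hypothesis HR'e : forall i, R' <= e i / 2.
Hypothesis HR'h : forall i, R' <= h i / 2.
Let E : PX T -> Prop := fun y => prod_ball dist x (rad / 4) y /\
  exists al, Jp al /\ Delta_rect dist (Rs al) rho a y.
Hypothesis HE : prod_sigma dist E.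
Hypothesis Hubiq : cB * m (prod_ball dist x (rad / 4)) <= m E.

Let he i : 0 < h i < e i.
Proof.
split; first exact: Rpower_gt0.
rewrite /h /e /Rpower; apply: exp_increasing.
have : ln rho < 0 by rewrite -ln_1; apply: ln_increasing; lra.
by have := Ht i; nra.
Qed.

Let Q (z : J * PX T) i := ball (dist i) (z.2 i) (e i).
Let CZ (z : J * PX T) := Jp z.1 /\ (forall i, Rs z.1 i (z.2 i)) /\
  exists q, prod_ball dist x (rad / 4) q /\ rectangle (Q z) q.
(** The halved sizes leave room for a ball of radius [R']: around a point of [Sz z] it stays in the
    box [Q z] and in the full [h]-neighbourhood. *)
Let Sz (z : J * PX T) i := fun y => ball (dist i) (z.2 i) (e i / 2) y /\
  Delta (dist i) (Rs z.1 i) (h i / 2) y.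
Let Bz (w : J * PX T * PX T) i := ball (dist i) (w.2 i) R'.
(** An [R']-ball whose centre is within 2 r of [x0] stays within 3 r, since [R' <= r]. *)
Let Tz (x0 : PX T) r (z : J * PX T) i := fun y => ball (dist i) (z.2 i) (e i) y /\
  Delta (dist i) (Rs z.1 i) (h i) y /\ ball (dist i) (x0 i) (3 * r) y.

Let open_Q z : open_box (Q z).
Proof. by move=> i; exact: open_ball. Qed.
Let open_B w : open_box (Bz w).
Proof. by move=> i; exact: open_ball. Qed.
Let open_S z : open_box (Sz z).
Proof. by move=> i; apply: open_and; [exact: open_ball | exact: open_Delta]. Qed.
Let open_T x0 r z : open_box (Tz x0 r z).
Proof.
by move=> i; apply: open_and; [exact: open_ball | apply: open_and; [exact: open_Delta | exact: open_ball]].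
Qed.

Let PK := prodI (fun _ : 'I_d => K).
Let PKi := prodI (fun _ : 'I_d => / K).

Let PK_gt0 : 0 < PK.
Proof. exact: prodI_pos. Qed.

Let PKi_gt0 : 0 < PKi.
Proof. by apply: prodI_pos => _; exact: Rinv_0_lt_compat. Qed.

Let PKPKi : PK * PKi = 1.
Proof.
rewrite /PK /PKi -prodI_mult /prodI.
by elim: (enum _) => [|k s IH] //=; rewrite IH; field; lra.
Qed.

Let ball_lower i y r r' : 0 < r <= r0 -> r / 4 <= r' ->
  0 < / K * Rpower r (delta i) <= mi i (ball (dist i) y r').
Proof.
move=> Hr Hr'; split; first by apply: Rmult_lt_0_compat; [exact: Rinv_0_lt_compat | exact: Rpower_gt0].
have [H _] := Hreg i; have {}H := H y r Hr.
have : mi i (ball (dist i) y (r / 4)) <= mi i (ball (dist i) y r').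
  by apply: (mu_le (Hmi i)); try (exact: open_ball); move=> p; rewrite /ball; lra.
move=> H'; apply: Rle_trans H'; apply: (Rmult_le_reg_l K) => //.
by rewrite -Rmult_assoc Rinv_r ?Rmult_1_l //; lra.
Qed.

Let ball_upper i y r r' : 0 < r <= r0 -> r' <= 7 * r ->
  mi i (ball (dist i) y r') <= K * Rpower r (delta i).
Proof.
move=> Hr Hr'; have [_ [H _]] := Hreg i; apply: Rle_trans (H y r Hr).
by apply: (mu_le (Hmi i)); try (exact: open_ball); move=> p; rewrite /ball; lra.
Qed.

Let he_r0 i : 0 < e i <= r0.
Proof. by have := he i; have := He i; lra. Qed.

Let HR'_r0 (i : 'I_d) : 0 < R' <= r0.
Proof. by have := he_r0 i; have := HR'e i; lra. Qed.

Lemma next_generation : exists Y : seq (J * PX T * PX T),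
  0 < count_list (fun _ => True) Y /\
  (forall w, List.In w Y -> Jp w.1.1 /\ (forall i, dist i (x i) (w.2 i) < rad / 2) /\
     forall p, prod_ball dist w.2 R' p -> Delta_rect dist (Rs w.1.1) rho (fun i => a i + t i) p) /\
  forall (x0 : PX T) A r, r = Rpower rho A -> R' <= r <= rad ->
    count_list (fun w => prod_ball dist x0 (2 * r) w.2) Y * Rpower rad (sumI delta) <=
    PK ^ 8 / cB * Rpower rho (sumI (fun i => coord_exponent (delta i) kappa (a i) (t i) A)) *
      count_list (fun _ => True) Y.
Proof.
(* [Z] indexes a maximal disjoint family of boxes around points of the resonant sets near [x], [Y] a
   maximal disjoint family of [R']-balls in the thinner neighbourhoods inside these boxes.  Disjointness
   and maximality turn measures into cardinalities ([I1] to [I4]); the measures of the traces of a ball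
   cancel against those of the boxes in [I5]. *)
pose Pe := prodI (fun i => Rpower (e i) (delta i)).
pose Pv := prodI (fun i => scale_vol (delta i) kappa (e i) (h i)).
pose PR := prodI (fun i => Rpower R' (delta i)).
have Pe0 : 0 < Pe by apply: prodI_pos => i; exact: Rpower_gt0.
have Pv0 : 0 < Pv by apply: prodI_pos => i; exact: scale_vol_gt0.
have PR0 : 0 < PR by apply: prodI_pos => i; exact: Rpower_gt0.
have [Z [Z1 [Z2 Z3]]] := maximal_disjoint_boxes (C := CZ) open_Q (Rmult_lt_0_compat _ _ PKi_gt0 Pe0)
  ltac:(by move=> z _; rewrite -prodI_mult; apply: open_box_measure_ge => // i; apply: ball_lower => //;
        have := he i; lra).
pose CY (w : J * PX T * PX T) := List.In w.1 Z /\ rectangle (Sz w.1) w.2.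
have [Y [Y1 [Y2 Y3]]] := maximal_disjoint_boxes (C := CY) open_B (Rmult_lt_0_compat _ _ PKi_gt0 PR0)
  ltac:(by move=> w _; rewrite -prodI_mult;
    apply: open_box_measure_ge => // i; apply: ball_lower; [exact: HR'_r0 | lra]).
have {}Z1 := proj1 (List.Forall_forall _ _) Z1; have {}Y1 := proj1 (List.Forall_forall _ _) Y1.
have SQ z p : rectangle (Sz z) p -> rectangle (Q z) p.
  by move=> Hp i; have [H _] := Hp i; rewrite /Q /ball in H *; have := he i; lra.
have disjoint_sub (A : J * PX T -> forall i, T i -> Prop) :
    (forall z p, rectangle (A z) p -> rectangle (Q z) p) ->
    List.ForallOrdPairs (fun x y => forall p, rectangle (A x) p -> rectangle (A y) p -> False) Z.
  move=> HA; elim: Z2 => [|z s Hz _ IH]; constructor=> //.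
  by apply: List.Forall_impl Hz => w Hw p /HA H1 /HA H2; exact: Hw H2.
have I1 : cB * (PKi * Rpower rad (sumI delta)) <= count_list (fun _ => True) Z * (PK * Pe).
  apply: (Rle_trans _ (m E)).
    apply: Rle_trans Hubiq; apply: Rmult_le_compat_l; first exact: Rlt_le.
    rewrite -prodI_Rpower -prodI_mult; apply: open_box_measure_ge => i; first exact: open_ball.
    by apply: ball_lower => //; lra.
  apply: (covering_bound (proj1 Hm) (A := fun z : J * PX T =>
    rectangle (fun i => ball (dist i) (z.2 i) (7 * e i)))) => //.
  - by move=> z; apply: open_box_sigma => i; exact: open_ball.
  - move=> z Hz _; rewrite -prodI_mult; apply: open_box_measure_le => [i|i]; first exact: open_ball.
    by apply: ball_upper => //; lra.
  - move=> p [Hp [al [Jal Hal]]].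
    (* Resonant sets are products, so points chosen in each coordinate form a point of one;
       maximality of [Z] provides a chosen box meeting the box around it. *)
    have [q Hq] : exists q : PX T, forall i, Rs al i (q i) /\ dist i (p i) (q i) < e i.
      exists (fun i => proj1_sig (constructive_indefinite_description _ (Hal i))) => i.
      by case: (constructive_indefinite_description _ _).
    have [|z [Hz [p' [H1 H2]]]] := Z3 (al, q).
      split=> //; split; first by move=> i; have [] := Hq i.
      by exists p; split=> // i; rewrite /Q /ball /= (dist_sym (Hmetric i)); have [] := Hq i.
    exists z; split=> //; split=> // i; have {}H1 := H1 i; have {}H2 := H2 i; have [_ Hqi] := Hq i.
    rewrite /Q /ball /= in H1 H2 *.
    have := dist_tri (Hmetric i) (z.2 i) (p' i) (p i); have := dist_tri (Hmetric i) (p' i) (q i) (p i).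
    have := dist_sym (Hmetric i) (p' i) (q i); have := dist_sym (Hmetric i) (p i) (q i); have := he i; lra.
have I2 : count_list (fun _ => True) Z * (PKi * Pv) <= count_list (fun _ => True) Y * (PK * PR).
  have HS (z : J * PX T) := open_box_sigma (@open_S z).
  have HU := sigma_union (fun _ => True) HS HE Z.
  apply: (Rle_trans _ _ _ (packing_bound (proj1 Hm) HS HU (disjoint_sub _ SQ) _ _)).
  - move=> z Hz _; rewrite -prodI_mult; apply: open_box_measure_ge => // i; split.
      by apply: Rmult_lt_0_compat; [exact: Rinv_0_lt_compat | exact: scale_vol_gt0].
    have [_ [_ [H _]]] := Hreg i; have [_ [Hz' _]] := Z1 z Hz.
    have {}H := H z.1 (z.2 i) (e i) (h i) (Hz' i) (he i) (proj2 (he_r0 i)).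
    apply: (Rmult_le_reg_l K) => //; rewrite -Rmult_assoc Rinv_r ?Rmult_1_l //; lra.
  - by move=> z Hz _ p Hp; exists z.
  apply: (covering_bound (proj1 Hm) (A := fun w : J * PX T * PX T =>
    rectangle (fun i => ball (dist i) (w.2 i) (7 * R')))) => //.
  - by move=> w; apply: open_box_sigma => i; exact: open_ball.
  - move=> w Hw _; rewrite -prodI_mult; apply: open_box_measure_le => [i|i]; first exact: open_ball.
    by apply: ball_upper; [exact: HR'_r0 | lra].
  - move=> p [z [Hz [_ Hp]]]; have [|w [Hw [q [H1 H2]]]] := Y3 (z, p); first by split.
    exists w; split=> //; split=> // i; have {}H1 := H1 i; have {}H2 := H2 i.
    rewrite /Bz /ball /= in H1 H2 *.
    have := dist_tri (Hmetric i) (w.2 i) (q i) (p i); have := dist_sym (Hmetric i) (p i) (q i); lra.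
have cZ : 0 < count_list (fun _ => True) Z.
  have : 0 < cB * (PKi * Rpower rad (sumI delta)).
    by apply: Rmult_lt_0_compat => //; apply: Rmult_lt_0_compat => //; exact: Rpower_gt0.
  have : 0 < PK * Pe by exact: Rmult_lt_0_compat.
  by have := count_list_ge0 (fun _ => True) Z; nra.
have cY : 0 < count_list (fun _ => True) Y.
  have : 0 < count_list (fun _ => True) Z * (PKi * Pv) by do 2!apply: Rmult_lt_0_compat => //.
  have : 0 < PK * PR by exact: Rmult_lt_0_compat.
  by have := count_list_ge0 (fun _ => True) Y; nra.
exists Y; split=> //; split.
  move=> w Hw; have [HwZ HwS] := Y1 w Hw; have [Jw [Rw [q [Hq1 Hq2]]]] := Z1 _ HwZ.
  split=> //; split=> [i|p Hp i].
    have {}Hq1 := Hq1 i; have {}Hq2 := Hq2 i; have [Hw1 _] := HwS i; rewrite /Q /ball in Hq1 Hq2 Hw1.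
    have := dist_tri (Hmetric i) (x i) (q i) (w.2 i); have := dist_tri (Hmetric i) (q i) (w.1.2 i) (w.2 i).
    have := dist_sym (Hmetric i) (q i) (w.1.2 i); have := He i; have := he i; lra.
  have {}Hp := Hp i; have [_ [q' [Rq Hq']]] := HwS i; exists q'; split=> //; rewrite /ball in Hp.
  have := dist_tri (Hmetric i) (p i) (w.2 i) q'; have := dist_sym (Hmetric i) (p i) (w.2 i).
  have := HR'h i; rewrite -/(h i); lra.
move=> x0 A r Hr Hrr.
pose P1 z := exists q, prod_ball dist x0 (2 * r) q /\ rectangle (Q z) q.
pose P2 (w : J * PX T * PX T) := prod_ball dist x0 (2 * r) w.2.
(* A box of size [e i] meeting the ball of radius 2 r lies within 2 r + 2 [e i] <= 7 [mx i] of [x0].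
   The power of [mx i] in [Pm] cancels the one by which [W] divides. *)
pose mx i := Rmax r (e i).
have mx1 i : r <= mx i by exact: Rmax_l.
have mx2 i : e i <= mx i by exact: Rmax_r.
have mx3 i : 0 < mx i <= r0.
  by have := he i; split; [have := mx2 i; lra | apply: Rmax_lub; have := he_r0 i; lra].
pose Pm := prodI (fun i => Rpower (mx i) (delta i)).
pose f i := coord_exponent (delta i) kappa (a i) (t i) A.
pose W i := K * scale_vol (delta i) kappa (e i) (h i) * Rpower rho (f i) * / Rpower (mx i) (delta i).
pose Pw := prodI W.
have Pm0 : 0 < Pm by apply: prodI_pos => i; exact: Rpower_gt0.
have I3 : count_list P2 Y * (PKi * PR) <= count_list P1 Z * Pw.
  have HT (z : J * PX T) := open_box_sigma (@open_T x0 r z).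
  have HU := sigma_union P1 HT HE Z.
  apply: (Rle_trans _ _ _ (packing_bound (proj1 Hm) (fun w => open_box_sigma (@open_B w)) HU Y2 _ _)).
  - move=> w Hw _; rewrite -prodI_mult; apply: open_box_measure_ge => // i.
    by apply: ball_lower; [exact: HR'_r0 | lra].
  - move=> w Hw Pw2 p Hp; have [HwZ HwS] := Y1 w Hw; exists w.1; split=> //; split.
      by exists w.2; split=> //; exact: SQ.
    move=> i; have {}Hp := Hp i; have {}Pw2 := Pw2 i; have [Hs1 [q [Rq Hq]]] := HwS i.
    rewrite /Bz /ball in Hp Hs1 Pw2.
    have := HR'h i; have := HR'e i; have := dist_sym (Hmetric i) (p i) (w.2 i).
    move=> G1 G2 G3; split; [|split].
    + by rewrite /ball; have := dist_tri (Hmetric i) (w.1.2 i) (w.2 i) (p i); lra.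
    + by exists q; split=> //; have := dist_tri (Hmetric i) (p i) (w.2 i) q; lra.
    + by rewrite /ball; have := dist_tri (Hmetric i) (x0 i) (w.2 i) (p i); lra.
  apply: (covering_bound (proj1 Hm) HT HU) => // z Hz _.
  apply: open_box_measure_le => // i; have [_ [Rz _]] := Z1 z Hz.
  have := neighbourhood_bound (Hmetric i) (Hmi i) (Hreg i) (x0 i) (A := A) (a := a i) (Rz i) HK Hrho (Ht i).
  rewrite -Hr -/(e i) -/(h i) -/(mx i) -/(f i) => /(_ (proj2 (he_r0 i)) ltac:(lra)) H.
  apply: (Rmult_le_reg_r (Rpower (mx i) (delta i))); first exact: Rpower_gt0.
  apply: Rle_trans H _; rewrite /W [X in _ <= X]Rmult_assoc Rinv_l ?Rmult_1_r; first by apply: Rle_refl.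
  exact: Rgt_not_eq (Rpower_gt0 _ _).
have I4 : count_list P1 Z * (PKi * Pe) <= PK * Pm.
  have HB : open_box (fun i => ball (dist i) (x0 i) (7 * mx i)) by move=> i; exact: open_ball.
  apply: (Rle_trans _ _ _ (packing_bound (proj1 Hm) (fun z => open_box_sigma (@open_Q z))
    (open_box_sigma HB) Z2 _ _)).
  - move=> z Hz _; rewrite -prodI_mult; apply: open_box_measure_ge => // i; apply: ball_lower => //.
    by have := he i; lra.
  - move=> z Hz [q [Hq1 Hq2]] p Hp i; have {}Hq1 := Hq1 i; have {}Hq2 := Hq2 i; have {}Hp := Hp i.
    rewrite /Q /ball in Hq1 Hq2 Hp *.
    have := dist_tri (Hmetric i) (x0 i) (q i) (p i); have := dist_tri (Hmetric i) (q i) (z.2 i) (p i).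
    have := dist_sym (Hmetric i) (q i) (z.2 i); have := mx1 i; have := mx2 i; have := mx3 i; lra.
  by rewrite -prodI_mult; apply: open_box_measure_le => // i; apply: ball_upper => //; lra.
have I5 : Pw * Pm = PK * Pv * Rpower rho (sumI f).
  rewrite -prodI_Rpower -!prodI_mult /prodI; elim: (enum _) => [|k s IH] //=; rewrite IH /W.
  by field; exact: Rgt_not_eq (Rpower_gt0 _ _).
have Pw0 : 0 < Pw.
  apply: prodI_pos => i; apply: Rmult_lt_0_compat; last exact: Rinv_0_lt_compat (Rpower_gt0 _ _).
  by apply: Rmult_lt_0_compat (Rpower_gt0 _ _); apply: Rmult_lt_0_compat => //; exact: scale_vol_gt0.
exact: proportion_algebra PKPKi HcB Pe0 Pv0 PR0 Pw0 (Rpower_gt0 _ _) (count_list_ge0 _ _) I1 I2 I3 I4 I5.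
Qed.
End Generation.
End ProductSpace.

(** * The descent *)

(** Without a cluster point, the open sets that the sequence eventually avoids cover [C]; a finite
    subcover would leave no place for late terms. *)
Lemma compact_cluster (T : Type) (dist : T -> T -> R) (C : T -> Prop) (y : nat -> T) :
  is_metric dist -> compact_set dist C -> (forall n, C (y n)) ->
  exists z, forall eps N, 0 < eps -> exists n, (N <= n)%coq_nat /\ dist z (y n) < eps.
Proof.
move=> Hd HC Hy; apply: NNPP => Hn.
have Hz z : exists eps N, 0 < eps /\ forall n, (N <= n)%coq_nat -> eps <= dist z (y n).
  apply: NNPP => H; apply: Hn; exists z => eps N Heps; apply: NNPP => H'; apply: H.
  by exists eps, N; split=> // n HNn; apply: Rnot_lt_le => Hlt; apply: H'; exists n.
have [||s [Hs1 Hs2]] := HC (fun V => open_set dist V /\ exists N, forall n, (N <= n)%coq_nat -> ~ V (y n)).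
- by move=> V [].
- move=> z _; have [eps [N [Heps HN]]] := Hz z; exists (ball dist z eps); split.
    split; first exact: open_ball.
    by exists N => n /HN H; rewrite /ball; lra.
  by rewrite /ball dist_refl.
have [N HN] : exists N, forall V, List.In V s -> forall n, (N <= n)%coq_nat -> ~ V (y n).
  elim: s Hs1 {Hs2} => [|V s IH] Hs1; first by exists O.
  have [N HN] := IH (fun V' HV' => Hs1 V' (or_intror HV')).
  have [_ [N' HN']] := Hs1 V (or_introl erefl).
  by exists (N + N')%coq_nat => V' [<-|HV'] n Hn'; [apply: HN' | apply: HN => //]; lia.
by have [V [HV Vy]] := Hs2 _ (Hy N); exact: HN Vy.
Qed.

Lemma term_le_sum (f : nat -> R) n : (forall k, 0 <= f k) -> f n <= sum_f_R0 f n.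
Proof.
move=> H; case: n => [|n] /=; first by lra.
by have := cond_pos_sum f n H; lra.
Qed.

Lemma sum_f_R0_scal (f : nat -> R) c N : sum_f_R0 (fun n => c * f n) N = c * sum_f_R0 f N.
Proof. by elim: N => [|N IH] /=; rewrite ?IH; ring. Qed.

Section Descent.
Variables (d : nat) (T : 'I_d -> Type) (dist : forall i, T i -> T i -> R).
Arguments dist : clear implicits.
Variables (mi : forall i, (T i -> Prop) -> R) (m : (PX T -> Prop) -> R).
Arguments mi : clear implicits.
Hypothesis Hd : (0 < d)%N.
Hypothesis Hmetric : forall i, is_metric (dist i).
Hypothesis Hmi : forall i, is_measure (borel (dist i)) (mi i).
Hypothesis Hm : is_product_measure dist mi m.
Variables (J : Type) (beta : J -> R) (l u : nat -> R) (rho : R -> R).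
Hypothesis HJ : countably_infinite J.
Hypothesis Hbeta : forall al, 0 < beta al.
Hypothesis Hlu : forall n, l n <= u n.
Hypothesis Hl : forall M, exists N, forall n, (N <= n)%N -> M < l n.
Hypothesis Hrho0 : forall x, 0 < x -> 0 < rho x.
Hypothesis Hrho : forall x y, 0 < x -> x <= y -> rho y <= rho x.
Hypothesis Hrho_lim : forall eps, 0 < eps -> exists M, forall x, M <= x -> rho x < eps.
Variable Rs : J -> forall i, T i -> Prop.
Arguments Rs : clear implicits.
Variables (delta a t : 'I_d -> R) (kappa K r0 c : R).
Hypothesis HK : 0 < K.
Hypothesis Hdelta : forall i, 0 < delta i.
Hypothesis Ha : forall i, 0 < a i.
Hypothesis Ht : forall i, 0 < t i.
Hypothesis Hkappa : 0 <= kappa < 1.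
Hypothesis Hreg : forall i,
  regular_scaling (dist i) (mi i) (fun al => Rs al i) (delta i) kappa K r0.
Hypothesis Hc : 0 < c.
Hypothesis Hubiq : forall (x : PX T) (r : R), 0 < r -> forall (N : nat) (eta : R), 0 < eta ->
  exists n, (N <= n)%N /\
    c * m (prod_ball dist x r) - eta <
    m (fun y => prod_ball dist x r y /\
         exists al, J_n beta l u n al /\ Delta_rect dist (Rs al) (rho (u n)) a y).
Variable s : R.
Hypothesis Hs : 0 < s < s_dim delta a t kappa.
Variables (U : nat -> PX T -> Prop) (rn : nat -> R).
Hypothesis Hdiam : forall n x y, U n x -> U n y -> prod_dist dist x y <= rn n.

Let D := sumI delta.
(** The proportion constant for half the ubiquity constant, the other half being spent on the
    limsup. The added 1 forces [cost_bound] below 1. *)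
Let C1 := prodI (fun _ : 'I_d => K) ^ 8 / (c / 2) + 1.

(** With this value, a charge of 2 on a proportion C1 (r_n/R)^s costs at most r_n^s / ([cost_bound]
    R^s). *)
Definition cost_bound : R := / (4 * C1).

Let C1_gt1 : 1 < C1.
Proof.
suff : 0 < prodI (fun _ : 'I_d => K) ^ 8 / (c / 2) by rewrite /C1; lra.
by apply: Rdiv_lt_0_compat; [apply: pow_lt; exact: prodI_pos | lra].
Qed.

Let tau_bounds : 0 < cost_bound < 1.
Proof.
rewrite /cost_bound; split; first by apply: Rinv_0_lt_compat; lra.
by rewrite -Rinv_1; apply: Rinv_lt_contravar; lra.
Qed.

Definition meets (y : PX T) (rad : R) (n : nat) : Prop := exists p, U n p /\ prod_ball dist y rad p.

Definition cheaply_met (y : PX T) (rad : R) : Prop :=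
  forall N, sum_f_R0 (fun n => indic (meets y rad n) * Rpower (rn n) s) N
    <= cost_bound * Rpower rad s.

(** One set with r_n >= R would alone cost R^s, more than the allowance because [cost_bound < 1]. *)
Lemma cheaply_met_small y rad n : 0 < rad -> cheaply_met y rad -> meets y rad n -> rn n < rad.
Proof.
move=> Hrad HG Hn; apply: Rnot_le_lt => Hle.
have := @Rpower_base_le rad (rn n) s ltac:(lra) Hrad Hle.
have := HG n; have := @term_le_sum (fun n => indic (meets y rad n) * Rpower (rn n) s) n.
rewrite indicT // => /(_ (fun k => Rmult_le_pos _ _ (indic_ge0 _) (Rlt_le _ _ (Rpower_gt0 _ _)))).
by have := Rpower_gt0 rad s; nra.
Qed.

(** Countability of [J] enters here: the union is enumerated, indices outside [J_n] contributing the
    empty set. *)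
Lemma ubiquity_set_sigma x rad n : prod_sigma dist (fun y => prod_ball dist x rad y /\
  exists al, J_n beta l u n al /\ Delta_rect dist (Rs al) (rho (u n)) a y).
Proof.
have [f [g [fK gK]]] := HJ.
have Hb : prod_sigma dist (prod_ball dist x rad).
  by apply: open_box_sigma => i; exact: open_ball.
apply: sigma_and => //.
apply: (sg_ext (A := fun y => exists k, (fun k y => J_n beta l u n (g k) /\
    Delta_rect dist (Rs (g k)) (rho (u n)) a y) k y)).
  apply: sg_union => k; case: (classic (J_n beta l u n (g k))) => Hk.
    apply: (sg_ext (A := Delta_rect dist (Rs (g k)) (rho (u n)) a)); last by move=> y; tauto.
    by apply: open_box_sigma => i; exact: open_Delta.
  by apply: sg_ext (sigma_False Hb) _ => y; tauto.
by move=> y; split=> [[k Hk]|[al Hal]]; [exists (g k) | exists (f al); rewrite fK].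
Qed.

Lemma meets_near (x0 : PX T) n r R' y : U n x0 -> rn n <= r -> R' <= r -> meets y R' n ->
  prod_ball dist x0 (2 * r) y.
Proof.
move=> Ux Hr HR [p [Up Hp]] i; have {}Hp := Hp i.
have := le_maxI (fun i => dist i (x0 i) (p i)) i; have := Hdiam Ux Up; rewrite /prod_dist /ball in Hp *.
have := dist_tri (Hmetric i) (x0 i) (p i) (y i); have := dist_sym (Hmetric i) (y i) (p i); lra.
Qed.

(** Below [eta] the gap supplies the gain 1/(2 C1). Above [eta], r exceeds every rh^(a_i), so [A] is
    at most every [a i] and the exponent is exactly A D. *)
Lemma exponent_bound rad rh eta r : 0 < rad -> 0 < rh < 1 ->
  (forall r, 0 < r -> r <= eta -> Rpower r (s_dim delta a t kappa - s) <= Rpower rad (D - s) / (2 * C1)) ->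
  (forall i, Rpower rh (a i) <= eta) -> 0 < r <= rad -> r < 1 ->
  exists A, r = Rpower rh A /\
  (Rpower rh (sumI (fun i => coord_exponent (delta i) kappa (a i) (t i) A)) <= Rpower r s * Rpower rad (D - s)) /\
  (r <= eta -> Rpower rh (sumI (fun i => coord_exponent (delta i) kappa (a i) (t i) A))
     <= Rpower r s * (Rpower rad (D - s) / (2 * C1))).
Proof.
move=> Hrad Hrh Heta Hai Hr Hr1.
have HsD : s_dim delta a t kappa <= D by exact: s_dim_le_sum.
have lrh : ln rh < 0 by rewrite -ln_1; apply: ln_increasing; lra.
have lr : ln r < 0 by rewrite -ln_1; apply: ln_increasing; lra.
pose A := ln r / ln rh.
have HA : r = Rpower rh A.
  by rewrite /Rpower /A (_ : ln r / ln rh * ln rh = ln r) ?exp_ln; [|lra|field; lra].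
have HA0 : 0 <= A.
  have -> : A = (- ln r) / (- ln rh) by rewrite /A; field; lra.
  by apply: Rlt_le; apply: Rdiv_lt_0_compat; lra.
pose F := sumI (fun i => coord_exponent (delta i) kappa (a i) (t i) A); have P0 := Rpower_gt0 rad (D - s).
have HF : r <= eta -> Rpower rh F <= Rpower r s * (Rpower rad (D - s) / (2 * C1)).
  move=> Hre; apply: (Rle_trans _ (Rpower rh (s_dim delta a t kappa * A))).
    by apply: Rpower_exp_antitone => //; exact: s_dim_le_exponent.
  rewrite Rmult_comm -Rpower_mult -HA; have -> : s_dim delta a t kappa = s + (s_dim delta a t kappa - s) by ring.
  rewrite Rpower_plus; apply: Rmult_le_compat_l; first exact: Rlt_le (Rpower_gt0 _ _).
  by apply: Heta; lra.
exists A; split=> //; split=> //.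
case: (Rle_dec r eta) => [/HF H|Hre].
  apply: Rle_trans H _; apply: Rmult_le_compat_l; first exact: Rlt_le (Rpower_gt0 _ _).
  apply: (Rmult_le_reg_r (2 * C1)); first by lra.
  have -> : Rpower rad (D - s) / (2 * C1) * (2 * C1) = Rpower rad (D - s) by field; lra.
  by nra.
rewrite -/F; have -> : F = A * D.
  rewrite -sumI_scal; apply: sumI_ext => i; rewrite coord_exponent_low //; first by ring.
  apply: Rnot_lt_le => HaA; have := @Rpower_exp_antitone rh (a i) A Hrh (Rlt_le _ _ HaA).
  by rewrite -HA; have := Hai i; lra.
rewrite -Rpower_mult -HA {1}(_ : D = s + (D - s)); last by ring.
rewrite Rpower_plus; apply: Rmult_le_compat_l; first exact: Rlt_le (Rpower_gt0 _ _).
by apply: Rpower_base_le; lra.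
Qed.

Lemma descent_step x rad M : 0 < rad <= r0 -> rad < 1 -> cheaply_met x rad ->
  exists y R' al, 0 < R' <= rad / 4 /\ (forall i, dist i (x i) (y i) < rad / 2) /\ M < beta al /\
    (forall p, prod_ball dist y R' p -> Delta_rect dist (Rs al) (rho (beta al)) (fun i => a i + t i) p) /\
    cheaply_met y R'.
Proof.
move=> Hrad Hrad1 HG.
pose gap := s_dim delta a t kappa - s; have Hgap : 0 < gap by rewrite /gap; lra.
have P0 x' y' := Rpower_gt0 x' y'.
have Hq : 0 < Rpower rad (D - s) / (2 * C1) by apply: Rdiv_lt_0_compat => //; lra.
have [eta1 [Heta1 Hsmall]] := Rpower_small Hq Hgap.
pose eta := Rmin eta1 (rad / 8).
have Heta : 0 < eta by apply: Rmin_glb_lt => //; lra.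
have [rho1 [Hrho1 Hrho1s]] : exists v, 0 < v /\ forall i r, 0 < r -> r <= v -> Rpower r (a i) <= eta.
  apply: (uniform_lower (P := fun i v => forall r, 0 < r -> r <= v -> Rpower r (a i) <= eta)).
    by move=> i v v' Hv' Hvv H r H1 H2; apply: H => //; lra.
  by move=> i; exact: Rpower_small.
have [M1 HM1] := @Hrho_lim (Rmin rho1 (/ 2)) ltac:(apply: Rmin_glb_lt => //; lra).
(* Exceeding 1 keeps [u n] positive, exceeding [M] yields [M < beta al], and exceeding [M1] makes
   [rho (u n)] small. *)
have [N HN] := Hl (Rmax 1 (Rmax M M1)).
have Hmball : 0 < m (prod_ball dist x (rad / 4)).
  apply: (Rlt_le_trans _ (prodI (fun i => / K * Rpower rad (delta i)))).
    by apply: prodI_pos => i; apply: Rmult_lt_0_compat => //; exact: Rinv_0_lt_compat.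
  apply: (open_box_measure_ge Hm) => [i|i]; first exact: open_ball.
  split; first by apply: Rmult_lt_0_compat => //; exact: Rinv_0_lt_compat.
  have [H _] := Hreg i; have {}H := H (x i) rad Hrad.
  by apply: (Rmult_le_reg_l K) => //; rewrite -Rmult_assoc Rinv_r ?Rmult_1_l //; lra.
have [n [HnN Hn]] := @Hubiq x (rad / 4) ltac:(lra) N (c / 2 * m (prod_ball dist x (rad / 4)))
   ltac:(apply: Rmult_lt_0_compat => //; lra).
have Hln := HN n HnN.
have Hln1 := Rmax_l 1 (Rmax M M1); have Hln2 := Rmax_r 1 (Rmax M M1).
have Hln3 := Rmax_l M M1; have Hln4 := Rmax_r M M1.
have Hun := Hlu n; set rh := rho (u n) in Hn.
have Hrh0 : 0 < rh by apply: Hrho0; lra.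
have Hrhm := HM1 (u n) ltac:(lra); rewrite -/rh in Hrhm.
have Hrh1 : rh <= rho1 by have := Rmin_l rho1 (/ 2); lra.
have Hrh2 : rh < / 2 by have := Rmin_r rho1 (/ 2); lra.
have Hrh : 0 < rh < 1 by lra.
have Hai i : Rpower rh (a i) <= eta by exact: Hrho1s.
have Heta8 : eta <= rad / 8 by exact: Rmin_r.
have Heta1' : eta <= eta1 by exact: Rmin_l.
(* Since rh < 1/2, the summand 1 supplies the factor 1/2, and the sum dominates each [a i + t i]. *)
pose B := 1 + sumI (fun i => a i + t i); pose R' := Rpower rh B.
have HR'h i : R' <= Rpower rh (a i + t i) / 2.
  apply: (Rle_trans _ (Rpower rh (1 + (a i + t i)))).
    apply: Rpower_exp_antitone => //; apply: Rplus_le_compat_l.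
    by apply: (le_sumI (f := fun i => a i + t i)) => k; have := Ha k; have := Ht k; lra.
  rewrite Rpower_plus Rpower_1 //; have := P0 rh (a i + t i); nra.
have HR'e i : R' <= Rpower rh (a i) / 2.
  apply: Rle_trans (HR'h i) _.
  have := @Rpower_exp_antitone rh (a i) (a i + t i) Hrh ltac:(have := Ht i; lra); lra.
pose i0 := Ordinal Hd.
have HR'0 : 0 < R' by exact: P0.
have HR'eta : R' <= eta / 2 by have := HR'e i0; have := Hai i0; lra.
have [Y [cY [HY1 HY2]]] := next_generation (cB := c / 2) Hmetric Hmi Hm HK Ht Hreg Hrad Hrh HR'0 ltac:(lra)
  (fun i => Rle_trans _ _ _ (Hai i) Heta8) HR'e HR'h (ubiquity_set_sigma x (rad / 4) n) ltac:(lra).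
pose tR := cost_bound * Rpower R' s.
have HtR : 0 < tR by apply: Rmult_lt_0_compat => //; lra.
(* Once some child has total cost at most 1, a charge of 2 excludes every set with r_n > [R'] from
   meeting it, and the remaining costs say that it is cheaply met. *)
pose q k := if Rle_dec (rn k) R' then Rpower (rn k) s / tR else 2.
have q0 k : 0 <= q k.
  by rewrite /q; case: Rle_dec => _ /=; [apply: Rlt_le; apply: Rdiv_lt_0_compat | lra].
pose phi (w : J * PX T * PX T) k := q k * indic (meets w.2 R' k).
have phi0 w k : 0 <= phi w k by apply: Rmult_le_pos => //; exact: indic_ge0.
set nY := count_list (fun _ => True) Y in cY HY2.
pose tr := cost_bound * Rpower rad s.
have Htr : 0 < tr by apply: Rmult_lt_0_compat => //; lra.
(* The averaged cost of each set is bounded by a multiple of its cost for the parent ball, so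
   summing over [k] uses only [HG]. A set missing the parent misses every child, as rad/2 + [R'] <=
   rad. *)
have Hterm k : sum_list (fun w => phi w k) Y <= nY / tr * (indic (meets x rad k) * Rpower (rn k) s).
  rewrite /phi sum_list_scal -/(count_list (fun w => meets w.2 R' k) Y).
  case: (classic (meets x rad k)) => Hk; last first.
    rewrite (indicF Hk) Rmult_0_l Rmult_0_r.
    have : count_list (fun w => meets w.2 R' k) Y <= 0 * sum_list (fun _ => 0) Y.
      rewrite -sum_list_scal; apply: sum_list_le => w Hw; rewrite indicF; first by lra.
      move=> [p [Up Hp]]; apply: Hk; exists p; split=> // i.
      have [_ [Hd' _]] := HY1 w Hw; have {}Hp := Hp i; rewrite /ball in Hp *.
      by have := dist_tri (Hmetric i) (x i) (w.2 i) (p i); have := Hd' i; lra.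
    by have := q0 k; nra.
  have Hrk := @cheaply_met_small x rad k ltac:(lra) HG Hk; have [x0 [Ux0 _]] := Hk.
  rewrite (indicT Hk) Rmult_1_l.
  (* Counting is available only at radii at least [R']; smaller sets are treated as having diameter
     [R']. *)
  pose r := Rmax (rn k) R'; have Hr1 : rn k <= r by exact: Rmax_l.
  have Hr2 : R' <= r by exact: Rmax_r.
  have Hr3 : r <= rad by apply: Rmax_lub; lra.
  have [A [HrA [HA1 HA2]]] := @exponent_bound rad rh eta r ltac:(lra) Hrh
    (fun r' H1 H2 => Hsmall r' H1 (Rle_trans _ _ _ H2 Heta1')) Hai ltac:(lra) ltac:(lra).
  have {HY2} := HY2 x0 A r HrA (conj Hr2 Hr3).
  move: HA1 HA2; set Pf := Rpower rh _; set y0 := count_list _ Y => HA1 HA2 HY2.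
  have Hy0 : count_list (fun w => meets w.2 R' k) Y <= y0.
    apply: sum_list_le => w _; case: (classic (meets w.2 R' k)) => Hw.
      by rewrite !indicT //; [lra | exact: meets_near Ux0 Hr1 Hr2 Hw].
    by rewrite indicF //; exact: indic_ge0.
  (* For r_n <= [R'] the cost contains 1/[cost_bound] = 4 C1, and the gain 1/(2 C1), valid since
     [R' <= eta], compensates the proportion constant. For r_n > [R'] the charge 2 needs no gain. *)
  have Hqk : q k * C1 * Pf <= 4 * C1 * Rpower (rn k) s * Rpower rad (D - s).
    rewrite /q; case: Rle_dec => Hk' /=.
      have Hr : r = R' by rewrite /r Rmax_right.
      apply: (Rle_trans _ (Rpower (rn k) s / tR * C1 * (Rpower r s * (Rpower rad (D - s) / (2 * C1))))).
        apply: Rmult_le_compat_l; last by apply: HA2; lra.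
        by apply: Rmult_le_pos; [apply: Rlt_le; apply: Rdiv_lt_0_compat | lra].
      rewrite Hr /tR /cost_bound.
      have -> : Rpower (rn k) s / (/ (4 * C1) * Rpower R' s) * C1 *
          (Rpower R' s * (Rpower rad (D - s) / (2 * C1)))
        = 2 * C1 * Rpower (rn k) s * Rpower rad (D - s).
        by have := P0 R' s; move=> ?; field; lra.
      have : 0 < Rpower (rn k) s * Rpower rad (D - s) by exact: Rmult_lt_0_compat.
      by nra.
    have Hr : r = rn k by rewrite /r Rmax_left //; lra.
    rewrite Hr in HA1; have : 0 < Rpower (rn k) s * Rpower rad (D - s) by exact: Rmult_lt_0_compat.
    by have : 2 * C1 * Pf <= 2 * C1 * (Rpower (rn k) s * Rpower rad (D - s));
      [apply: Rmult_le_compat_l; lra | nra].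
  apply: (Rle_trans _ (q k * y0)); first exact: Rmult_le_compat_l.
  apply: (Rmult_le_reg_r (Rpower rad D)) => //.
  have -> : nY / tr * Rpower (rn k) s * Rpower rad D = nY * (4 * C1 * Rpower (rn k) s * Rpower rad (D - s)).
    rewrite {1}(_ : D = s + (D - s)); last by ring.
    by rewrite Rpower_plus /tr /cost_bound; field; split; [lra | exact: Rgt_not_eq].
  apply: (Rle_trans _ (nY * (q k * C1 * Pf))); last by apply: Rmult_le_compat_l; lra.
  rewrite Rmult_assoc (_ : nY * (q k * C1 * Pf) = q k * (C1 * Pf * nY)); last by ring.
  apply: Rmult_le_compat_l => //; apply: Rle_trans HY2 _.
  apply: Rmult_le_compat_r; first by lra.
  apply: Rmult_le_compat_r; first exact: Rlt_le (P0 _ _).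
  by rewrite /C1; lra.
have [w [Hw Hphi]] : exists w, List.In w Y /\ forall N, sum_f_R0 (phi w) N <= 1.
  apply: averaging => // N'; rewrite -/nY.
  apply: Rle_trans (sum_Rle _ _ _ (fun k _ => Hterm k)) _.
  rewrite sum_f_R0_scal; apply: (Rle_trans _ (nY / tr * tr)); last by apply: Req_le; field; lra.
  apply: Rmult_le_compat_l; last exact: HG.
  by apply: Rlt_le; apply: Rdiv_lt_0_compat.
have [[Hw1 Hw2] [Hw3 Hw4]] := HY1 w Hw.
exists w.2, R', w.1.1; split; first by lra.
split=> //; split; first by lra.
split.
  (* As [beta al <= u n] and [rho] is non-increasing, passing from [rho (u n)] to [rho (beta al)]
     only enlarges the neighbourhood. *)
  move=> p /Hw4 Hp i; have [z [Rz Hz]] := Hp i; exists z; split=> //.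
  apply: Rlt_le_trans Hz _; apply: Rpower_base_le => //; first by have := Ha i; have := Ht i; lra.
  exact: Hrho.
move=> N'; apply: (Rle_trans _ (sum_f_R0 (fun k => tR * phi w k) N')).
  apply: sum_Rle => k _; rewrite /phi; case: (classic (meets w.2 R' k)) => Hk; last first.
    by rewrite !indicF //; lra.
  rewrite !indicT //; have := Hphi k; have := @term_le_sum (phi w) k (phi0 w).
  rewrite /phi indicT // /q; case: Rle_dec => _ /=; last by lra.
  by move=> _ _; apply: Req_le; field; lra.
rewrite sum_f_R0_scal; have := Hphi N'; rewrite -/tR; nra.
Qed.
End Descent.

(** * The limit point and the lower bound *)

Lemma nested_balls_meet (d : nat) (T : 'I_d -> Type) (dist : forall i, T i -> T i -> R)
    (y : nat -> PX T) (rad : nat -> R) (C : forall i, T i -> Prop) :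
  (forall i, is_metric (dist i)) -> (forall i, compact_set (dist i) (C i)) ->
  (forall k, 0 < rad k) -> (forall k, rad k.+1 <= rad k / 4) ->
  (forall k i, dist i (y k i) (y k.+1 i) < rad k / 2) ->
  (forall i p, ball (dist i) (y 0%N i) (rad 0%N) p -> C i p) ->
  exists z, forall k, prod_ball dist (y k) (rad k) z.
Proof.
move=> Hm HC Hr0 Hr Hy HyC.
(* From rad (k+1) <= rad k / 4 follows rad k / 2 <= 2/3 (rad k - rad (k+1)), which telescopes.
   Centres drift by less than 2/3 rad k, and the remaining third lets a mere cluster point, taken in
   each coordinate separately, lie in every open ball. *)
have Hdist k j i : dist i (y k i) (y (k + j)%coq_nat i) <= 2 / 3 * (rad k - rad (k + j)%coq_nat).
  elim: j => [|j IH]; first by rewrite -plus_n_O dist_refl //; lra.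
  rewrite -plus_n_Sm; have := dist_tri (Hm i) (y k i) (y (k + j)%coq_nat i) (y (k + j)%coq_nat.+1 i).
  by have := Hy (k + j)%coq_nat i; have := Hr (k + j)%coq_nat; lra.
have [z Hz] : exists z : PX T, forall i eps N, 0 < eps ->
    exists n, (N <= n)%coq_nat /\ dist i (z i) (y n i) < eps.
  have Hex i : exists zi, forall eps N, 0 < eps -> exists n, (N <= n)%coq_nat /\ dist i zi (y n i) < eps.
    apply: (compact_cluster (Hm i) (HC i)) => n; apply: HyC; rewrite /ball.
    by have := Hdist 0%N n i; have := Hr0 0%N; have := Hr0 n; rewrite /=; lra.
  exists (fun i => proj1_sig (constructive_indefinite_description _ (Hex i))) => i.
  by case: (constructive_indefinite_description _ _).
exists z => k i; rewrite /ball.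
have [n [Hn Hzn]] := Hz i (rad k / 3) k ltac:(have := Hr0 k; lra).
have := Hdist k (Nat.sub n k) i; rewrite (_ : (k + Nat.sub n k)%coq_nat = n); last by lia.
have := dist_tri (Hm i) (y k i) (y n i) (z i); have := dist_sym (Hm i) (z i) (y n i); have := Hr0 n; lra.
Qed.

(** The crude bound rad k (1 + k) <= rad 0 reduces the claim to the Archimedean property. *)
Lemma quarter_sequence_small (rad : nat -> R) eps : 0 < eps -> (forall k, 0 < rad k) ->
  (forall k, rad k.+1 <= rad k / 4) -> exists k, rad k < eps.
Proof.
move=> Heps Hr0 Hr; have Hk k : rad k * (1 + INR k) <= rad 0%N.
  elim: k => [|k IH]; first by rewrite /=; lra.
  by rewrite S_INR; have := Hr k; have := Hr0 k; have := pos_INR k; nra.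
have [k Hk'] := INR_unbounded (rad 0%N / eps); exists k; apply: Rnot_le_lt => Hle.
have H : rad 0%N = rad 0%N / eps * eps by field; lra.
by have := Hk k; have := Hr0 0%N; have := pos_INR k; nra.
Qed.

Theorem mainTheorem1
  (d : nat) (Hd : (0 < d)%nat)
  (T : 'I_d -> Type) (dist : forall i, T i -> T i -> R)
  (Hmetric : forall i, is_metric (dist i))
  (Hbounded : forall i, bounded_space (dist i))
  (Hlc : forall i, locally_compact (dist i))
  (mi : forall i, (T i -> Prop) -> R)
  (Hmi : forall i, borel_probability (dist i) (mi i))
  (m : (PX T -> Prop) -> R) (Hm : is_product_measure dist mi m)
  (delta : 'I_d -> R) (Hdelta : forall i, 0 < delta i)
  (Hahlfors : forall i, ahlfors_regular (dist i) (mi i) (delta i))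
  (J : Type) (HJ : countably_infinite J)
  (beta : J -> R) (Hbeta_pos : forall alpha, 0 < beta alpha)
  (Hbeta_fin : forall M, 1 < M -> finite_pred (fun alpha => beta alpha < M))
  (l u : nat -> R)
  (Hl_incr : forall n k, (n <= k)%nat -> l n <= l k)
  (Hu_incr : forall n k, (n <= k)%nat -> u n <= u k)
  (Hlu : forall n, l n <= u n)
  (Hl_infty : forall M, exists N, forall n, (N <= n)%nat -> M < l n)
  (rho : R -> R)
  (Hrho_pos : forall x, 0 < x -> 0 < rho x)
  (Hrho_noninc : forall x y, 0 < x -> x <= y -> rho y <= rho x)
  (Hrho_lim : forall eps, 0 < eps -> exists M, forall x, M <= x -> rho x < eps)
  (Rs : J -> forall i, T i -> Prop)
  (kappa : R) (Hkappa : 0 <= kappa < 1)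
  (Hscaling : forall i, kappa_scaling (dist i) (mi i) (delta i) kappa (fun alpha => Rs alpha i))
  (a : 'I_d -> R) (Ha : forall i, 0 < a i)
  (Hubiq : local_ubiquity dist m Rs beta l u rho a)
  (t : 'I_d -> R) (Ht : forall i, 0 < t i) :
  dimH_ge (prod_dist dist) (W_set dist Rs beta rho a t) (s_dim delta a t kappa).
Proof.
move=> s Hs0 Hnull; apply: Rnot_lt_le => Hslt.
have Hmeas i : is_measure (borel (dist i)) (mi i) by case: (Hmi i).
(* Each factor is nonempty because it has measure 1. *)
have [x0 _] : exists x0 : PX T, True.
  have Hex i : exists x : T i, True.
    apply: NNPP => Hn; have [[H0 _] H1] := Hmi i.
    suff : (fun _ : T i => True) = (fun _ => False) by move=> H; rewrite H H0 in H1; lra.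
    by apply: pred_ext => y; split=> // _; apply: Hn; exists y.
  by exists (fun i => proj1_sig (constructive_indefinite_description _ (Hex i))).
(* A single [v] plays three parts: the radius bound, the inverse of the constant [K], and the radius
   of a ball inside a compact set. All three persist when [v] decreases. *)
have [v [Hv0 Hv]] : exists v, 0 < v /\ forall i,
    regular_scaling (dist i) (mi i) (fun al => Rs al i) (delta i) kappa (/ v) v /\
    exists C, compact_set (dist i) C /\ forall y, ball (dist i) (x0 i) v y -> C y.
  apply: (uniform_lower (P := fun i v =>
    regular_scaling (dist i) (mi i) (fun al => Rs al i) (delta i) kappa (/ v) v /\
    exists C, compact_set (dist i) C /\ forall y, ball (dist i) (x0 i) v y -> C y)) => [i v w Hw Hwv|i].
    move=> [HR [C [HC1 HC2]]]; split.
      by apply: regular_scaling_mono HR => //; apply: Rinv_le_contravar.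
    by exists C; split=> // y Hy; apply: HC2; apply: Rlt_le_trans Hwv.
  have [K [r0 [HK [Hr0 HR]]]] := regular_scaling_exists (Hmetric i) (Hmeas i) (Hahlfors i) (Hscaling i).
  have [C [HC1 [r [Hr HC2]]]] := Hlc i (x0 i).
  have HK' : 0 < / K by exact: Rinv_0_lt_compat.
  pose v := Rmin (/ K) (Rmin r0 r).
  have Hv1 : v <= / K by exact: Rmin_l.
  have Hv2 : v <= r0 by apply: Rle_trans (Rmin_r _ _) _; exact: Rmin_l.
  have Hv3 : v <= r by apply: Rle_trans (Rmin_r _ _) _; exact: Rmin_r.
  have Hv : 0 < v by do 2!apply: Rmin_glb_lt => //.
  exists v; split=> //; split; last by exists C; split=> // y Hy; apply: HC2; apply: Rlt_le_trans Hv3.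
  apply: regular_scaling_mono HR => //.
  by rewrite -(Rinv_inv K); apply: Rinv_le_contravar.
have HK : 0 < / v by exact: Rinv_0_lt_compat.
have Hreg i := proj1 (Hv i).
have [C HC] : exists C : forall i, T i -> Prop, forall i, compact_set (dist i) (C i) /\
    forall y, ball (dist i) (x0 i) v y -> C i y.
  exists (fun i => proj1_sig (constructive_indefinite_description _ (proj2 (Hv i)))) => i.
  by case: (constructive_indefinite_description _ _).
have [c [Hc Hub]] := Hubiq.
pose R0 := Rmin v (/ 2).
have HR0 : 0 < R0 <= v by split; [apply: Rmin_glb_lt => //; lra | exact: Rmin_l].
have HR01 : R0 < 1 by have := Rmin_r v (/ 2); rewrite -/R0; lra.
have Hs : 0 < s < s_dim delta a t kappa by [].
(* A cover of total cost at most this number makes the initial ball cheaply met, whichever sets meet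
   it. *)
have Htau : 0 < cost_bound d (/ v) c * Rpower R0 s.
  apply: Rmult_lt_0_compat (Rpower_gt0 _ _); apply: Rinv_0_lt_compat.
  suff : 0 < prodI (fun _ : 'I_d => / v) ^ 8 / (c / 2) by lra.
  by apply: Rdiv_lt_0_compat; [apply: pow_lt; exact: prodI_pos | lra].
have [U [rn [Hrn [Hdiam [Hcov Hsum]]]]] := Hnull 1 _ ltac:(lra) Htau.
have Hrn0 n : 0 < rn n by case: (Hrn n).
pose good (b : PX T * R) := 0 < b.2 <= R0 /\ cheaply_met dist (/ v) c s U rn b.1 b.2.
(* Goodness is carried by the type so that the ball picked by choice can be fed back into the
   recursion. *)
pose St := {b : PX T * R | good b}.
pose next (k : nat) (b b' : PX T * R) := b'.2 <= b.2 / 4 /\ (forall i, dist i (b.1 i) (b'.1 i) < b.2 / 2) /\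
  exists al, INR k < beta al /\
    forall p, prod_ball dist b'.1 b'.2 p -> Delta_rect dist (Rs al) (rho (beta al)) (fun i => a i + t i) p.
have step (k : nat) (b : St) : exists b' : St, next k (proj1_sig b) (proj1_sig b').
  case: b => -[y r] [/= Hr Hg].
  have [y' [r' [al [H1 [H2 [H3 [H4 H5]]]]]]] := descent_step Hd Hmetric Hmeas Hm HJ Hbeta_pos Hlu Hl_infty
    Hrho_pos Hrho_noninc Hrho_lim HK Hdelta Ha Ht Hkappa Hreg Hc Hub Hs Hdiam (INR k)
    (conj (proj1 Hr) (Rle_trans _ _ _ (proj2 Hr) (proj2 HR0))) (Rle_lt_trans _ _ _ (proj2 Hr) HR01) Hg.
  have Hg' : good (y', r') by split=> //=; lra.
  by exists (exist _ (y', r') Hg'); split; [case: H1 | split=> //; exists al].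
have good0 : good (x0, R0).
  split; first by split=> /=; lra.
  move=> N; apply: Rle_trans (Hsum N); apply: sum_Rle => k _ /=.
  rewrite -[X in _ <= X]Rmult_1_l; apply: Rmult_le_compat_r; first exact: Rlt_le (Rpower_gt0 _ _).
  by rewrite /indic; case: excluded_middle_informative => _ /=; lra.
pose nxt k b : St := proj1_sig (constructive_indefinite_description _ (step k b)).
pose st := nat_rect (fun _ => St) (exist _ (x0, R0) good0 : St) nxt.
pose b k := proj1_sig (st k).
have Hb k : good (b k) by exact: proj2_sig (st k).
have Hnext k : next k (b k) (b k.+1).
  by rewrite /b /st /= /nxt; case: (constructive_indefinite_description _ _).
have Hb0 k : 0 < (b k).2 by have [[]] := Hb k.
have Hb4 k : (b k.+1).2 <= (b k).2 / 4 by have [] := Hnext k.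
have [z Hz] : exists z, forall k, prod_ball dist (b k).1 (b k).2 z.
  apply: (nested_balls_meet (y := fun k => (b k).1) (rad := fun k => (b k).2)
    Hmetric (fun i => proj1 (HC i))) => //.
    by move=> k; have [_ []] := Hnext k.
  move=> i p Hp; apply: (proj2 (HC i)); apply: Rlt_le_trans Hp _.
  by have [H _] := Hb 0%N; lra.
have [|n Hn] := Hcov z.
  move=> [L HL].
  (* Step k used an index with [beta] above k, so no finite list contains all the indices whose
     neighbourhoods hold [z]. *)
  have [k Hk] : exists k : nat, forall al, List.In al L -> beta al <= INR k.
    elim: (L) => [|al L' [k Hk]]; first by exists 0%N.
    have [k' Hk'] := INR_unbounded (beta al); exists (k + k')%coq_nat => al'.
    rewrite plus_INR; have := pos_INR k; have := pos_INR k'.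
    by move=> ? ? [<-|/Hk]; lra.
  have [_ [_ [al [Hal1 Hal2]]]] := Hnext k.
  by have := Hk al (HL al (Hal2 z (Hz k.+1))); lra.
(* Once the radius is below r_n, a cheaply met ball cannot meet [U n], yet [z] lies in both. *)
have [k Hk] := quarter_sequence_small (Hrn0 n) Hb0 Hb4.
have [_ Hg] := Hb k.
have : meets dist U (b k).1 (b k).2 n by exists z.
by move=> /(cheaply_met_small HK Hc Hs (Hb0 k) Hg); lra.
Qed.
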